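(* Consider the hypotheses $h_W(x)=Wx$ with $W\in\mathbb R^{C\times d}$, and let $m:=Cd$. Assume that $\|x\|\le M$ for all $x\in X\subset\mathbb R^d$. Let $L(z,y)$ be a loss function taking values in an interval $[A',A]\subset\mathbb R$ on the domain $\mathbb R^C$ (i.e. for $z\in\mathbb R^C$ and every $y\in Y$), and assume that, for every $y$, the map $z\mapsto L(z,y)$ is $\ell$-Lipschitz and $\beta$-smooth. Let $D$ be a distribution over $X\times Y$ and let $\Theta:=\{W\in\mathbb R^{C\times d}:\|W\|_F\le R\}$. Fix $\sigma>0$ and let $\delta\in(0,1)$. Then, with probability at least $1-\delta$ over $S\sim D^n$, we have uniformly for all $W\in\Theta$, $$\begin{aligned}L_D(h_W)\le L_S(h_W)&+2\sqrt2\,\frac{\beta R\sigma CM^2}{\sqrt n}+4\beta CM^2\sigma^2\sqrt{\frac{2\ln(8/\delta)}{n}}\\&+(A-A')\sqrt{\frac{\frac{\|W\|_F^2}{2\sigma^2}+\ln\big(\tfrac{2n}{\delta}\big)}{2(n-1)}}.\end{aligned}$$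
   Context: For $n=1$ the right-hand side is read as $+\infty$. $L_D(h):=\mathbb E_{(x,y)\sim D}[L(h(x),y)]$ and, for $S=\{(x_i,y_i)\}_{i=1}^n$, $L_S(h):=\frac1n\sum_{i=1}^nL(h(x_i),y_i)$. A map $z\mapsto L(z,y)$ is $\beta$-smooth if it is differentiable with $\beta$-Lipschitz gradient (Euclidean norm). $\|\cdot\|_F$ is the Frobenius norm. *)

(* Defs.v *)
From HB Require Import structures.
From mathcomp Require Import all_boot all_order all_algebra.
From mathcomp Require Import all_classical all_reals all_analysis.
Set Implicit Arguments.
Unset Strict Implicit.
Unset Printing Implicit Defensive.
Import Order.TTheory GRing.Theory Num.Theory.
Import numFieldNormedType.Exports.
Local Open Scope classical_set_scope.
Local Open Scope ring_scope.

(* Spaces of matrices (in particular of column vectors) over the reals carry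
   their Borel sigma-algebra. *)
HB.instance Definition _ (R : realType) (m n : nat) :=
  Measurable.copy 'M[R]_(m, n) (g_sigma_algebraType (@open 'M[R]_(m, n))).

Section norms.
Context {R : realType}.

(* The library norm `|_| on matrices is the sup norm, hence these two. *)
Definition enorm {n : nat} (x : 'cV[R]_n) : R :=
  Num.sqrt (\sum_(i < n) x i 0 ^+ 2).

Definition frobnorm {m n : nat} (A : 'M[R]_(m, n)) : R :=
  Num.sqrt (\sum_(i < m) \sum_(j < n) A i j ^+ 2).

End norms.

Section regularity.
Context {R : realType} {n : nat}.

Definition elipschitz (l : R) (f : 'cV[R]_n -> R) : Prop :=
  forall z z', `|f z - f z'| <= l * enorm (z - z').

Definition gradient (f : 'cV[R]_n -> R) (z : 'cV[R]_n) : 'cV[R]_n :=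
  \col_i 'D_(delta_mx i 0) f z.

Definition smooth (beta : R) (f : 'cV[R]_n -> R) : Prop :=
  (forall z, differentiable f z) /\
  (forall z z', enorm (gradient f z - gradient f z') <= beta * enorm (z - z')).

End regularity.

Section power.
Context {d : measure_display} {T : measurableType d} {R : realType}.

Definition tcons (n : nat) (p : T * n.-tuple T) : n.+1.-tuple T :=
  [tuple of p.1 :: p.2].

Lemma measurable_tcons (n : nat) : measurable_fun setT (@tcons n).
Proof.
exact: (measurable_cons measurable_fst measurable_snd).
Qed.

HB.instance Definition _ (n : nat) :=
  isMeasurableFun.Build _ _ _ _ (@tcons n) (@measurable_tcons n).

(* The n-fold product measure D^n, as the law of (z_1, ..., z_n) built by
   D^0 = the point mass at the empty tuple, D^(n+1) = D x D^n. *)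
Fixpoint power (D : probability T R) (n : nat) : probability (n.-tuple T) R :=
  match n with
  | 0 => dirac [tuple]
  | n'.+1 => distribution (D \x power D n')%E (@tcons n')
  end.

Lemma power_rectangle (D : probability T R) (n : nat) (A : 'I_n -> set T) :
  (forall i, measurable (A i)) ->
  (power D n [set S | forall i, A i (tnth S i)] = \prod_(i < n) D (A i))%E.
Proof.
elim: n A => [|n IH] A mA /=.
  by rewrite big_ord0 diracE mem_set//; case.
rewrite big_ord_recl /distribution /pushforward/=.
rewrite (_ : _ @^-1` _ =
  A ord0 `*` [set S | forall i, A (lift ord0 i) (tnth S i)]); last first.
  apply/seteqP; split => -[x S] /=.
    move=> h; split; first exact: (h ord0).
    by move=> i; have := h (lift ord0 i); rewrite /tcons tnthS.
  move=> [Ax AS] i; case: (unliftP ord0 i) => [j ->|->] //.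
  by rewrite /tcons tnthS.
rewrite product_measure1E//; last first.
  rewrite (_ : [set _ | _] = \bigcap_(i in [set: 'I_n])
    ((fun S => tnth S i) @^-1` A (lift ord0 i))); last first.
    by apply/seteqP; split => S /= h i; [move=> _|]; exact: h.
  apply: fin_bigcap_measurable => // i _; rewrite -[X in measurable X]setTI.
  exact: measurable_tnth.
by congr (_ * _)%E; exact: (IH (fun i => A (lift ord0 i))) (fun i => mA _).
Qed.

End power.

Section risk.
Context {R : realType} {dY : measure_display} {Y : measurableType dY}.
Context {C d : nat}.
Implicit Types (L : 'cV[R]_C -> Y -> R) (h : 'cV[R]_d -> 'cV[R]_C).

Definition risk L (D : probability ('cV[R]_d * Y)%type R) h : \bar R :=
  ('E_D[fun p => L (h p.1) p.2])%E.

Definition emp_risk L {n : nat} (S : n.-tuple ('cV[R]_d * Y)%type) h : R :=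
  n%:R^-1 * \sum_(i < n) L (h (tnth S i).1) (tnth S i).2.

Definition linhyp (W : 'M[R]_(C, d)) (x : 'cV[R]_d) : 'cV[R]_C := W *m x.

End risk.

(* Main.v *)
(* Write P_t for Gaussian smoothing of the weights at scale t, f for the loss and
   gap for L_D - L_S.  PAC-Bayes with prior N(0, sigma^2) and posterior
   N(W, sigma^2), whose relative entropy is |W|_F^2 / (2 sigma^2), bounds
   P_sigma gap by the last term.  To come back from P_sigma gap to gap, chain
   over the scales s = tau_(k+1) < t = tau_k, tau_k = sigma 2^-k, through
     P_s gap(f) - P_t gap(f) = P_s gap(f - P_t f) + P_t gap(P_s f - f).
   By beta-smoothness the functions f - P_t f are bounded by
   beta C M^2 t^2 / 2, while a Gaussian change of measure at scale t costs only
   r^2 / (2 t^2); hence PAC-Bayes bounds the k-th increment by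
   O(beta C M^2 r tau_k / sqrt n) plus a confidence term, and these sum
   geometrically to the two middle terms, with no Rademacher complexity.
   All the high-probability events follow from one Markov inequality, for a
   weighted sum of exponential moments under the priors. *)
Require Import Defs.
From mathcomp Require Import all_boot all_order all_algebra.
From mathcomp Require Import all_classical all_reals all_analysis.
From mathcomp Require Import measurable_realfun normal_distribution ring lra.
Import Order.TTheory GRing.Theory Num.Theory.
Import numFieldNormedType.Exports.
Local Open Scope classical_set_scope.
Local Open Scope ring_scope.
Set Implicit Arguments.
Unset Strict Implicit.
Unset Printing Implicit Defensive.

(** * Elementary inequalities for the exponential *)

(** The last term depends on |W|_F itself, the middle ones only on the radius of the weight ball.
    Hence two kinds of exponent: at scale sigma the squared gap, which requires no rate tuned to the
    posterior; for the increments a linear exponent, whose rate is fixed in advance by the largest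
    relative entropy allowed. The chain stops after n scales: with B = beta C M^2, what remains
    below tau_n is at most B sigma^2 / 4^n, and sqrt n <= 4^n absorbs it into the confidence term,
    so no limit is taken. Scale k receives twice the share (delta / 8)^(k+1) of the failure
    probability. The logarithm (k+1) ln(8 / delta) of its inverse is the source of the 8; the factor
    k+1 grows far more slowly than the ranges tau_k^2 shrink. *)

Section real_ineq.
Context {R : realType}.
Implicit Types f df : R -> R.

Lemma le_of_derive_ge0 f df : (forall x : R, is_derive x 1 f (df x)) ->
  (forall x, 0 <= x -> 0 <= df x) -> forall x, 0 <= x -> f 0 <= f x.
Proof.
move=> fdf df0 x x0.
have cf : {within `[0, x], continuous f}.
  by apply: derivable_within_continuous => y _; exact: ex_derive.
have [y] := MVT_segment x0 (fun y _ => fdf y) cf.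
rewrite in_itv/= => /andP[y0 _] fE.
by rewrite -subr_ge0 fE mulr_ge0 ?df0// subr_ge0.
Qed.

Lemma le_of_derive_le0 f df : (forall x : R, is_derive x 1 f (df x)) ->
  (forall x, x <= 0 -> df x <= 0) -> forall x, x <= 0 -> f 0 <= f x.
Proof.
move=> fdf df0 x x0.
have cf : {within `[x, 0], continuous f}.
  by apply: derivable_within_continuous => y _; exact: ex_derive.
have [y] := MVT_segment x0 (fun y _ => fdf y) cf.
rewrite in_itv/= => /andP[_ y0] fE.
by rewrite -subr_le0 fE mulr_le0_ge0 ?df0// subr_ge0.
Qed.

Lemma sinh_ge (x : R) : 0 <= x -> 2 * x <= expR x - expR (- x).
Proof.
move=> x0.
pose f (y : R) := expR y - expR (- y) - 2 * y.
suff : f 0 <= f x by rewrite /f oppr0 subrr mulr0 subr0 subr_ge0.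
apply: (@le_of_derive_ge0 f (fun y => expR y + expR (- y) - 2)) => //.
  move=> y; rewrite /f; apply: is_derive_eq.
  by rewrite /GRing.scale/=; ring.
move=> y _; rewrite expRN.
have e0 := expR_gt0 y.
have -> : expR y + (expR y)^-1 - 2 = (expR y - 1) ^+ 2 / expR y.
  by field; rewrite gt_eqF.
by rewrite divr_ge0 ?sqr_ge0// ltW.
Qed.

(** Since e^x + e^-x - 2 = (e^(x/2) - e^(-x/2))^2, this is the square of [sinh_ge] at x/2. It lets
    exponential moments control second moments. *)
Lemma cosh_ge (x : R) : 2 + x ^+ 2 <= expR x + expR (- x).
Proof.
have H (y : R) : 0 <= y -> 2 + y ^+ 2 <= expR y + expR (- y).
  move=> y0; have h0 : 0 <= y / 2 by rewrite divr_ge0.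
  have h := sinh_ge h0.
  have : (2 * (y / 2)) ^+ 2 <= (expR (y / 2) - expR (- (y / 2))) ^+ 2.
    by rewrite ler_sqr ?nnegrE//; [rewrite mulr_ge0|rewrite (le_trans _ h)// mulr_ge0].
  have -> : 2 * (y / 2) = y by field.
  have := expRxMexpNx_1 (y / 2).
  have -> : expR y = expR (y / 2) ^+ 2 by rewrite expr2 -expRD; congr expR; field.
  have -> : expR (- y) = expR (- (y / 2)) ^+ 2.
    by rewrite expr2 -expRD; congr expR; field.
  by move: (expR _) (expR (- _)) => u v uv; nra.
have [x0|/ltW x0] := leP 0 x; first exact: H.
by have := H (- x); rewrite oppr_ge0 opprK sqrrN (addrC (expR (- x))) => /(_ x0).
Qed.

Lemma expR_mulB_le1 (y : R) : expR y * (1 - y) <= 1.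
Proof.
rewrite -[leRHS](expRxMexpNx_1 y) ler_wpM2l ?expR_ge0//.
by rewrite (le_trans _ (expR_ge1Dx _)).
Qed.

(** Convexity of exp on the segment from 0 to z: the tangent at q z is evaluated at z ([h1]) and at
    0 ([h2]), and the two are averaged with weights q and 1 - q. *)
Lemma expR_chord_le (q z : R) : 0 <= q <= 1 -> expR (q * z) <= 1 + q * (expR z - 1).
Proof.
move=> /andP[q0 q1].
have h1 : expR (q * z) * (1 + (1 - q) * z) <= expR z.
  rewrite -[in leRHS](subrK (q * z) z) expRD mulrC ler_wpM2r ?expR_ge0//.
  by rewrite (le_trans _ (expR_ge1Dx _))// lerD2l; lra.
have h2 := expR_mulB_le1 (q * z).
have h3 := ler_wpM2l q0 h1.
have q1' : 0 <= 1 - q by lra.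
have h4 := ler_wpM2l q1' h2.
by move: h3 h4; move: (expR (q * z)) (expR z) => u v h3 h4; lra.
Qed.

(** The right-hand side is O(s^2) and the left-hand side linear in s. Instead of a limit, one small
    s = e x, with the sign of x, is inserted: then e x^2 <= (e x^2)(e v) with e v < 1. *)
Lemma eq0_of_mgf_bound (x v : R) : 0 <= v ->
  (forall s, s * x <= expR (s ^+ 2 * v / 2) - 1) -> x = 0.
Proof.
move=> v0 H; set D := 1 + v + x ^+ 2.
have x2 : 0 <= x ^+ 2 by exact: sqr_ge0.
have D0 : 0 < D by rewrite /D; lra.
pose e := D^-1.
have e0 : 0 < e by rewrite invr_gt0.
have De : D * e = 1 by rewrite mulfV// gt_eqF.
have ev : e * v <= 1 by rewrite -De mulrC ler_wpM2r ?ltW// /D; lra.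
have ex : e * x ^+ 2 <= 1 by rewrite -De mulrC ler_wpM2r ?ltW// /D; lra.
have ev0 : 0 <= e * v by rewrite mulr_ge0// ltW.
have ex0 : 0 <= e * x ^+ 2 by rewrite mulr_ge0// ltW.
pose y := (e * x) ^+ 2 * v / 2.
have yE : y = (e * x ^+ 2) * (e * v) / 2 by rewrite /y; field.
have y0 : 0 <= y by rewrite yE divr_ge0// mulr_ge0.
have y1 : y <= 1 / 2 by rewrite yE ler_pM2r ?invr_gt0// mulr_ile1.
have : expR y - 1 <= 2 * y by have := expR_mulB_le1 y; nra.
have := H (e * x); rewrite -/y => h1 h2.
have h3 : e * x ^+ 2 <= (e * x ^+ 2) * (e * v).
  by have := le_trans h1 h2; rewrite expr2 mulrA yE; lra.
have ev1 : e * v < 1 by rewrite -De mulrC ltr_pM2r// /D; lra.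
have : e * x ^+ 2 = 0 by apply/eqP; rewrite eq_le ex0 andbT; nra.
by move/eqP; rewrite mulf_eq0 gt_eqF//= sqrf_eq0 => /eqP.
Qed.

(** Comparison of the coefficients of s^2. If x > v, the explicit s^2 = (x - v) / D is small enough
    for the second order error to stay below the difference. *)
Lemma le_of_mgf_bound (x v : R) : 0 <= v -> 0 <= x ->
  (forall s, 2 + s ^+ 2 * x <= 2 * expR (s ^+ 2 * v / 2)) -> x <= v.
Proof.
move=> v0 x0 H; rewrite leNgt; apply/negP => vx.
set D := x * v + x + v + 1.
have xv0 : 0 <= x * v by rewrite mulr_ge0.
have D0 : 0 < D by rewrite /D; lra.
pose t := (x - v) / D.
have t0 : 0 < t by rewrite divr_gt0// subr_gt0.
have tD : t * D = x - v by rewrite /t divfK// gt_eqF.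
have := H (Num.sqrt t); rewrite (sqr_sqrtr (ltW t0)) => h1.
have h2 := expR_mulB_le1 (t * v / 2).
have tv0 : 0 <= t * v by rewrite mulr_ge0// ltW.
have tx0 : 0 <= t * x by rewrite mulr_ge0// ltW.
have txv0 : 0 <= t * (x * v) by rewrite mulr_ge0// ltW.
have e1 : t * (x * v) + t * x + t * v + t = x - v by rewrite -tD /D; ring.
have tv1 : t * v < 1.
  rewrite /t mulrAC ltr_pdivrMr// mul1r /D mulrBl; have := sqr_ge0 v.
  by rewrite expr2; lra.
have h3 : (1 + t * x / 2) * (1 - t * v / 2) <= 1.
  apply: (le_trans _ h2); rewrite ler_wpM2r//; lra.
have h4 : t * (x - v) <= t * (t * (x * v) / 2) by lra.
by move: h4; rewrite ler_pM2l//; lra.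
Qed.

(** The difference [g] of the logarithms vanishes to first order at 0, and its second derivative is
    1/4 - q (1 - q) >= 0, where q is the success probability of the exponentially tilted law. *)
Lemma bernoulli_mgf_le (p s : R) : 0 <= p <= 1 ->
  1 - p + p * expR s <= expR (s * p + s ^+ 2 / 8).
Proof.
move=> /andP[p0 p1].
pose D (x : R) := 1 - p + p * expR x.
have D0 x : 0 < D x.
  rewrite /D; have := expR_gt0 x; have [->|pn] := eqVneq p 1; first by lra.
  by move=> e0; rewrite ltr_pwDl ?subr_gt0 ?lt_neqAle ?pn// mulr_ge0// ltW.
have dD (x : R) : is_derive x 1 D (p * expR x).
  by rewrite /D; apply: is_derive_eq; rewrite /GRing.scale/=; ring.
pose g x := x * p + x ^+ 2 / 8 - ln (D x).
pose dg x := p + x / 4 - p * expR x * (D x)^-1.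
have gdg (x : R) : is_derive x 1 g (dg x).
  have dl : is_derive x 1 (@ln R \o D) ((D x)^-1 * (p * expR x)).
    by apply: is_derive1_comp; exact: is_derive1_ln.
  rewrite (_ : g = (fun x => x * p + x ^+ 2 / 8) - (@ln R \o D))//.
  by apply: is_derive_eq; rewrite /dg /GRing.scale/=; field; rewrite gt_eqF.
pose ddg x := 1 / 4 - p * expR x * (D x)^-1 * (1 - p * expR x * (D x)^-1).
have dgddg (x : R) : is_derive x 1 dg (ddg x).
  have dV : is_derive x 1 (fun x => (D x)^-1) (- (D x) ^- 2 *: (p * expR x)).
    by apply: is_deriveV; rewrite gt_eqF.
  rewrite (_ : dg = (fun x => p + x / 4) - (fun x => p * expR x) * (fun x => (D x)^-1))//.
  by apply: is_derive_eq; rewrite /ddg /GRing.scale/=; field; rewrite gt_eqF.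
have ddg0 x : 0 <= ddg x.
  rewrite /ddg; set q := p * expR x / D x.
  by have := sqr_ge0 (q - 1 / 2); rewrite expr2; lra.
have Dat0 : D 0 = 1 by rewrite /D expR0; ring.
have dg0 : dg 0 = 0 by rewrite /dg Dat0 expR0; field.
have g0 : g 0 = 0 by rewrite /g Dat0 ln1; ring.
have : 0 <= g s.
  rewrite -g0; have [s0|/ltW s0] := leP 0 s.
    apply: (le_of_derive_ge0 gdg) => // x x0.
    by rewrite -dg0; exact: (le_of_derive_ge0 dgddg).
  apply: (le_of_derive_le0 gdg) => // x x0.
  suff : dg 0 - dg x >= 0 by rewrite dg0 sub0r oppr_ge0.
  have cd : {within `[x, 0], continuous dg}.
    by apply: derivable_within_continuous => y _; exact: ex_derive.
  have [y _ ->] := MVT_segment x0 (fun y _ => dgddg y) cd.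
  by rewrite mulr_ge0// subr_ge0.
by rewrite /g subr_ge0 -ler_expR lnK ?posrE ?D0.
Qed.

End real_ineq.

(** * Integrals of bounded measurable functions *)

Section bounded_measurable.
Context {R : realType}.

(** Losses, gaps and their exponentials all lie in this class, which makes them integrable for every
    probability, so that integrals can be kept real-valued. *)
Definition bmeas {d} {T : measurableType d} (f : T -> R) :=
  measurable_fun setT f /\ exists K, forall x, `|f x| <= K.

Section basic.
Context {d} {T : measurableType d}.
Implicit Types f g : T -> R.

Lemma bmeas_cst (c : R) : bmeas (fun _ : T => c).
Proof. by split; [exact: measurable_cst|exists `|c|]. Qed.

Lemma bmeasD f g : bmeas f -> bmeas g -> bmeas (fun x => f x + g x).
Proof.
move=> [mf [K fK]] [mg [K' gK']]; split; first exact: measurable_funD.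
by exists (K + K') => x; rewrite (le_trans (ler_normD _ _))// lerD.
Qed.

Lemma bmeasM f g : bmeas f -> bmeas g -> bmeas (fun x => f x * g x).
Proof.
move=> [mf [K fK]] [mg [K' gK']]; split; first exact: measurable_funM.
by exists (K * K') => x; rewrite normrM ler_pM.
Qed.

Lemma bmeasZ (c : R) f : bmeas f -> bmeas (fun x => c * f x).
Proof. exact/bmeasM/bmeas_cst. Qed.

Lemma bmeasN f : bmeas f -> bmeas (fun x => - f x).
Proof.
move=> [mf [K fK]]; split; first exact: measurableT_comp mf.
by exists K => x; rewrite normrN.
Qed.

Lemma bmeasB f g : bmeas f -> bmeas g -> bmeas (fun x => f x - g x).
Proof. by move=> bf bg; apply: bmeasD => //; exact: bmeasN. Qed.

Lemma bmeas_expR f : bmeas f -> bmeas (fun x => expR (f x)).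
Proof.
move=> [mf [K fK]]; split; first exact: measurableT_comp mf.
exists (expR K) => x; rewrite ger0_norm ?expR_ge0// ler_expR.
by rewrite (le_trans (ler_norm _)).
Qed.

Lemma bmeas_sum (I : Type) (s : seq I) (f : I -> T -> R) :
  (forall i, bmeas (f i)) -> bmeas (fun x => \sum_(i <- s) f i x).
Proof.
move=> bf; elim: s => [|i s IH].
  by under eq_fun do rewrite big_nil; exact: bmeas_cst.
by under eq_fun do rewrite big_cons; exact: bmeasD.
Qed.

Lemma bmeas_comp d' (T' : measurableType d') (h : T' -> T) f :
  measurable_fun setT h -> bmeas f -> bmeas (f \o h).
Proof.
by move=> mh [mf [K fK]]; split; [exact: measurableT_comp|exists K => x; exact: fK].
Qed.

Variable P : probability T R.

Lemma bmeas_integrable f : bmeas f -> P.-integrable setT (EFin \o f).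
Proof.
move=> [mf [K fK]]; apply: measurable_bounded_integrable => //.
  by rewrite (le_lt_trans (probability_le1 _ _))// ltry.
exists K; split; first exact: num_real.
by move=> K' KK' x _ /=; rewrite (le_trans (fK x))// ltW.
Qed.

Lemma EFin_Rint f : bmeas f ->
  (\int[P]_x f x)%R%:E = (\int[P]_x (f x)%:E)%E.
Proof.
move=> bf; rewrite /Rintegral fineK//.
by apply: integrable_fin_num => //; exact: bmeas_integrable.
Qed.

Lemma Rint_cst (c : R) : \int[P]_x c = c.
Proof. by rewrite Rintegral_cst// [X in fine X]probability_setT mulr1. Qed.

Lemma RintD f g : bmeas f -> bmeas g ->
  \int[P]_x (f x + g x) = \int[P]_x f x + \int[P]_x g x.
Proof. by move=> bf bg; rewrite RintegralD//; exact: bmeas_integrable. Qed.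

Lemma RintB f g : bmeas f -> bmeas g ->
  \int[P]_x (f x - g x) = \int[P]_x f x - \int[P]_x g x.
Proof. by move=> bf bg; rewrite RintegralB//; exact: bmeas_integrable. Qed.

Lemma RintZ (c : R) f : bmeas f -> \int[P]_x (c * f x) = c * \int[P]_x f x.
Proof. by move=> bf; rewrite RintegralZl//; exact: bmeas_integrable. Qed.

Lemma Rint_sum (I : Type) (s : seq I) (f : I -> T -> R) :
  (forall i, bmeas (f i)) ->
  \int[P]_x (\sum_(i <- s) f i x) = \sum_(i <- s) \int[P]_x f i x.
Proof.
move=> bf; elim: s => [|i s IH].
  by under eq_Rintegral do rewrite big_nil; rewrite big_nil Rint_cst.
under eq_Rintegral do rewrite big_cons.
by rewrite big_cons RintD ?IH//; exact: bmeas_sum.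
Qed.

Lemma le_Rint f g : bmeas f -> bmeas g -> (forall x, f x <= g x) ->
  \int[P]_x f x <= \int[P]_x g x.
Proof. by move=> bf bg fg; apply: le_Rintegral => //; exact: bmeas_integrable. Qed.

Lemma Rint_ge (a : R) f : bmeas f -> (forall x, a <= f x) -> a <= \int[P]_x f x.
Proof.
by move=> bf af; rewrite -[leLHS](Rint_cst a); apply: le_Rint => //; exact: bmeas_cst.
Qed.

Lemma Rint_le (b : R) f : bmeas f -> (forall x, f x <= b) -> \int[P]_x f x <= b.
Proof.
by move=> bf af; rewrite -[leRHS](Rint_cst b); apply: le_Rint => //; exact: bmeas_cst.
Qed.

Lemma normr_Rint_le (b : R) f : bmeas f -> (forall x, `|f x| <= b) ->
  `|\int[P]_x f x| <= b.
Proof.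
move=> bf fb; rewrite ler_norml; apply/andP; split.
  by apply: Rint_ge => // x; have := fb x; rewrite ler_norml => /andP[].
by apply: Rint_le => // x; rewrite (le_trans (ler_norm _)).
Qed.

Lemma sqr_Rint_le f : bmeas f -> (\int[P]_x f x) ^+ 2 <= \int[P]_x (f x ^+ 2).
Proof.
move=> bf; set m := \int[P]_x f x.
have bf2 : bmeas (fun x => f x ^+ 2) by under eq_fun do rewrite expr2; exact: bmeasM.
have : 0 <= \int[P]_x (f x ^+ 2 - (2 * m * f x - m ^+ 2)).
  apply: Rint_ge.
    by apply: bmeasB => //; apply: bmeasB; [exact: bmeasZ|exact: bmeas_cst].
  move=> x; have -> : f x ^+ 2 - (2 * m * f x - m ^+ 2) = (f x - m) ^+ 2 by ring.
  exact: sqr_ge0.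
rewrite RintB//; last by apply: bmeasB; [exact: bmeasZ|exact: bmeas_cst].
rewrite RintB//; [|exact: bmeasZ|exact: bmeas_cst].
by rewrite RintZ// Rint_cst -/m => h; lra.
Qed.

Lemma Rint_markov f : bmeas f -> (forall x, 0 <= f x) ->
  (P [set x | (1 <= f x)%R] <= (\int[P]_x f x)%:E)%E.
Proof.
move=> bf f0; rewrite EFin_Rint//; have mf := bf.1.
rewrite (_ : [set x | 1 <= f x] = setT `&` [set x | (1%:E <= `|(EFin \o f) x|)%E]); last first.
  by rewrite setTI; apply/seteqP; split => x /=; rewrite lee_fin (ger0_norm (f0 x)).
have mf' : measurable_fun setT (EFin \o f) by exact/measurable_EFinP.
have := le_integral_abse P measurableT mf' ltr01.
rewrite mul1e => /le_trans; apply.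
by under eq_integral => x _ do rewrite /= (ger0_norm (f0 x)).
Qed.

End basic.

Section product.
Context {d1 d2} {T1 : measurableType d1} {T2 : measurableType d2}.
Variable f : T1 -> T2 -> R.
Hypothesis bf : bmeas (fun p : T1 * T2 => f p.1 p.2).

Lemma bmeas_section1 x : bmeas (f x).
Proof. exact: (bmeas_comp (pair1_measurable x) bf). Qed.

Lemma bmeas_section2 y : bmeas (f^~ y).
Proof. exact: (bmeas_comp (pair2_measurable y) bf). Qed.

Lemma bmeas_Rint (P2 : probability T2 R) : bmeas (fun x => \int[P2]_y f x y).
Proof.
split.
  (* The partial integral does not see the law on [T1]; a point mass serves as a dummy one. *)
  have := measurable_fubini_F (bmeas_integrable (dirac (point : T1) \x P2)%E bf).
  move=> mF; apply/measurable_EFinP; apply: eq_measurable_fun mF => x _ /=.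
  by rewrite EFin_Rint//; exact: bmeas_section1.
case: bf => _ [K fK]; exists K => x; apply: normr_Rint_le => [|y].
  exact: bmeas_section1.
exact: (fK (x, y)).
Qed.

Lemma bmeas_Rint2 (P1 : probability T1 R) : bmeas (fun y => \int[P1]_x f x y).
Proof.
split.
  have := measurable_fubini_G (bmeas_integrable (P1 \x dirac (point : T2))%E bf).
  move=> mG; apply/measurable_EFinP; apply: eq_measurable_fun mG => y _ /=.
  by rewrite EFin_Rint//; exact: bmeas_section2.
case: bf => _ [K fK]; exists K => y; apply: normr_Rint_le => [|x].
  exact: bmeas_section2.
exact: (fK (x, y)).
Qed.

Lemma Rint_fubini (P1 : probability T1 R) (P2 : probability T2 R) :
  \int[P1]_x (\int[P2]_y f x y) = \int[P2]_y (\int[P1]_x f x y).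
Proof.
have := Fubini (bmeas_integrable (P1 \x P2)%E bf) => /= FE.
apply: EFin_inj; rewrite EFin_Rint ?EFin_Rint; [|exact: bmeas_Rint2|exact: bmeas_Rint].
under eq_integral do (rewrite EFin_Rint; last exact: bmeas_section1).
under [RHS]eq_integral do (rewrite EFin_Rint; last exact: bmeas_section2).
exact: FE.
Qed.

End product.

End bounded_measurable.

(** * Gaussian measures *)

Section normal.
Context {R : realType}.
Local Notation mu := (@lebesgue_measure R).

(** The translated measure agrees with Lebesgue measure on half-open intervals, which determine
    it. *)
Lemma ge0_integral_lebesgue_shift (a : R) (F : R -> \bar R) :
  measurable_fun setT F -> (forall x, 0 <= F x)%E ->
  (\int[mu]_x F (x + a)%R = \int[mu]_x F x)%E.
Proof.
move=> mF F0.
have ms : measurable_fun setT (fun x : measurableTypeR R => x + a : measurableTypeR R).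
  exact: measurable_funD.
have := ge0_integral_pushforward ms mu measurableT mF.
rewrite preimage_setT => <-; last by move=> x _.
apply: eq_measure_integral => /= A mA _; apply/esym.
apply: lebesgue_measure_unique => // _ [[u v]] _ <-.
transitivity (mu ((fun x => x + a) @^-1` `]u, v]%classic)); last by [].
rewrite (_ : _ @^-1` _ = `]u - a, v - a]%classic); last first.
  by apply/seteqP; split => x /=; rewrite !in_itv/= ltrBlDr lerBrDr.
by rewrite !lebesgue_measure_itv/= !lte_fin ltrD2r -!EFinB opprB addrA subrK.
Qed.

(** The Radon--Nikodym derivative of the normal law and [normal_pdf] have equal integrals over every
    measurable set, hence agree almost everywhere. *)
Lemma ge0_integral_normal (m s : R) (F : R -> \bar R) :
  measurable_fun setT F -> (forall x, 0 <= F x)%E ->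
  (\int[normal_prob m s]_x F x = \int[mu]_x (F x * (normal_pdf m s x)%:E))%E.
Proof.
move=> mF F0.
rewrite -(Radon_Nikodym_SigmaFinite.change_of_variables (normal_prob_dominates m s))//.
apply: ae_eq_integral => //.
- apply: emeasurable_funM => //.
  apply: (measurable_int mu).
  exact: Radon_Nikodym_SigmaFinite.f_integrable (normal_prob_dominates m s).
- apply: emeasurable_funM => //; apply/measurable_EFinP.
  exact: measurable_normal_pdf.
- apply: ae_eqe_mul2l; apply: integral_ae_eq => //.
  + exact: Radon_Nikodym_SigmaFinite.f_integrable (normal_prob_dominates m s).
  + by apply/measurable_EFinP; exact: measurable_normal_pdf.
  + move=> A _ mA; rewrite -Radon_Nikodym_SigmaFinite.f_integral//.
    exact: normal_prob_dominates.
Qed.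

(** One-dimensional Cameron--Martin formula: the Lebesgue integral is translated by [a], and the
    quotient of the two densities is the exponential weight. *)
Lemma ge0_integral_normal_shift (a : R) (F : R -> \bar R) :
  measurable_fun setT F -> (forall x, 0 <= F x)%E ->
  (\int[normal_prob 0 1]_x F x =
   \int[normal_prob 0 1]_x (F (x + a)%R * (expR (- (a * x) - a ^+ 2 / 2))%:E))%E.
Proof.
move=> mF F0; rewrite ge0_integral_normal//.
rewrite -(ge0_integral_lebesgue_shift a)/=; last 2 first.
- apply: emeasurable_funM => //; apply/measurable_EFinP.
  exact: measurable_normal_pdf.
- by move=> x; rewrite mule_ge0// lee_fin normal_pdf_ge0.
rewrite ge0_integral_normal; last 2 first.
- apply: emeasurable_funM.
    apply: measurableT_comp => //; exact: measurable_funD.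
  apply/measurable_EFinP; apply: measurableT_comp => //.
  by apply: measurable_funB => //; apply: measurableT_comp => //; exact: measurable_funM.
- by move=> x; rewrite mule_ge0// lee_fin expR_ge0.
apply: eq_integral => x _; rewrite -muleA; congr (_ * _)%E.
rewrite -EFinM; congr EFin.
rewrite /normal_pdf oner_eq0 mulrCA; congr (_ * _).
rewrite /normal_fun -expRD; congr expR.
rewrite expr1n !subr0; by field.
Qed.

(** Times exp(c x^2 / 2), the standard density becomes (1 - c)^(-1/2) times the centred normal
    density of variance 1 / (1 - c). *)
Lemma normal_expR_sqr (c : R) : 0 <= c < 1 ->
  (\int[normal_prob 0 1]_x (expR (c / 2 * x ^+ 2))%:E = (Num.sqrt (1 - c))^-1%:E)%E.
Proof.
move=> /andP[c0 c1].
rewrite ge0_integral_normal; last 2 first.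
- apply/measurable_EFinP; apply: measurableT_comp => //.
  by apply: measurable_funM => //; exact: measurable_funX.
- by move=> x; rewrite lee_fin expR_ge0.
have c'0 : 0 < 1 - c by rewrite subr_gt0.
have s0 : 0 < Num.sqrt (1 - c) by rewrite sqrtr_gt0.
set s := (Num.sqrt (1 - c))^-1.
have sneq : s != 0 by rewrite invr_eq0 gt_eqF.
under eq_integral => x _.
  rewrite -EFinM (_ : _ * _ = s * normal_pdf 0 s x); last first.
    rewrite /normal_pdf oner_eq0 (negbTE sneq).
    rewrite /normal_peak /normal_fun !subr0 mulrCA -expRD expr1n mul1r.
    have s2 : s ^+ 2 = (1 - c)^-1 by rewrite /s exprVn sqr_sqrtr// ltW.
    rewrite mulrA; congr (_ * expR _); last first.
      by rewrite s2; field; rewrite gt_eqF.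
    rewrite -mulrnAr sqrtrM ?sqr_ge0// sqrtr_sqr ger0_norm ?invr_ge0 ?sqrtr_ge0//.
    by rewrite invfM mulrA mulfV// mul1r.
  rewrite EFinM.
  over.
rewrite ge0_integralZl//.
- by rewrite integral_normal_pdf mule1.
- apply/measurable_EFinP; exact: measurable_normal_pdf.
- by move=> x _; rewrite lee_fin normal_pdf_ge0.
- by rewrite lee_fin /s invr_ge0 ltW.
Qed.

End normal.

Section power.
Context {d} {T : measurableType d} {R : realType}.
Variable P : probability T R.

Lemma ge0_integral_powerS n (F : n.+1.-tuple T -> \bar R) :
  measurable_fun setT F -> (forall t, 0 <= F t)%E ->
  (\int[power P n.+1]_t F t =
   \int[P]_x \int[power P n]_t F [tuple of x :: t])%E.
Proof.
move=> mF F0; rewrite /= ge0_integral_distribution//.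
rewrite (fubini_tonelli1 (F \o @tcons _ _ n))//; last by move=> x; exact: F0.
exact: measurableT_comp.
Qed.

Lemma integral_power0 (F : 0.-tuple T -> \bar R) :
  measurable_fun setT F -> (\int[power P 0]_t F t = F [tuple])%E.
Proof. by move=> mF; rewrite integral_dirac// diracT mul1e. Qed.

End power.

(** * Standard Gaussian vectors and the Cameron--Martin formula *)

Section gauss.
Context {R : realType}.

Local Notation RT := (measurableTypeR R).

Definition gauss m : probability (m.-tuple RT) R :=
  power (normal_prob 0 1 : probability RT R) m.

Definition row_of m (t : m.-tuple RT) : 'rV[R]_m := \row_i tnth t i.

Definition dotr m (a b : 'rV[R]_m) : R := \sum_i a 0 i * b 0 i.

Definition shift_tuple m (a : 'rV[R]_m) (t : m.-tuple RT) : m.-tuple RT :=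
  [tuple tnth t i + a 0 i | i < m].

Lemma row_of_shift m (a : 'rV[R]_m) t : row_of (shift_tuple a t) = row_of t + a.
Proof. by apply/rowP => i; rewrite !mxE tnth_mktuple. Qed.

Lemma measurable_shift_tuple m (a : 'rV[R]_m) : measurable_fun setT (shift_tuple a).
Proof.
apply/measurable_fun_tnthP => i.
rewrite (_ : _ \o _ = fun t => tnth t i + a 0 i); last first.
  by apply/funext => t /=; rewrite tnth_mktuple.
by apply: measurable_funD => //; exact: measurable_tnth.
Qed.

Lemma measurable_dotr m (a : 'rV[R]_m) :
  measurable_fun setT (fun t : m.-tuple RT => dotr a (row_of t)).
Proof.
apply: measurable_sum => i; apply: measurable_funM => //.
under eq_fun do rewrite mxE.
exact: measurable_tnth.
Qed.

Lemma dotrZl m (c : R) (a b : 'rV[R]_m) : dotr (c *: a) b = c * dotr a b.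
Proof. by rewrite /dotr mulr_sumr; apply: eq_bigr => i _; rewrite mxE mulrA. Qed.

Lemma dotrZr m (c : R) (a b : 'rV[R]_m) : dotr a (c *: b) = c * dotr a b.
Proof. by rewrite /dotr mulr_sumr; apply: eq_bigr => i _; rewrite mxE mulrCA. Qed.

Lemma dotrNl m (a b : 'rV[R]_m) : dotr (- a) b = - dotr a b.
Proof. by rewrite -scaleN1r dotrZl mulN1r. Qed.

Lemma dotrNr m (a b : 'rV[R]_m) : dotr a (- b) = - dotr a b.
Proof. by rewrite -scaleN1r dotrZr mulN1r. Qed.

Lemma dotr_ge0 m (a : 'rV[R]_m) : 0 <= dotr a a.
Proof. by apply: sumr_ge0 => i _; rewrite -expr2 sqr_ge0. Qed.

Lemma measurable_shift_weight m (a : 'rV[R]_m) (F : m.-tuple RT -> \bar R) :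
  measurable_fun setT F ->
  measurable_fun setT (fun t => F (shift_tuple a t)
    * (expR (- dotr a (row_of t) - dotr a a / 2))%:E)%E.
Proof.
move=> mF; apply: emeasurable_funM.
  exact: (measurableT_comp mF (measurable_shift_tuple a)).
apply/measurable_EFinP/measurableT_comp => //.
apply: measurable_funB => //; apply: measurableT_comp => //.
exact: measurable_dotr.
Qed.

(** The weight is a product over the coordinates, so the one-dimensional formula treats the head and
    the induction hypothesis the tail. *)
Lemma ge0_integral_gauss_shift m (a : 'rV[R]_m) (F : m.-tuple RT -> \bar R) :
  measurable_fun setT F -> (forall t, 0 <= F t)%E ->
  (\int[gauss m]_t F t =
   \int[gauss m]_t (F (shift_tuple a t)
                    * (expR (- dotr a (row_of t) - dotr a a / 2))%:E))%E.
Proof.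
elim: m a F => [|m IH] a F mF F0.
  rewrite !integral_power0//; last exact: measurable_shift_weight.
  rewrite /dotr !big_ord0 mul0r oppr0 addr0 expR0 mule1; congr F.
  exact/esym/tuple0.
have mcons x : measurable_fun setT (fun t : m.-tuple RT => [tuple of x :: t]).
  by apply: measurable_cons.
pose a0 := a 0 ord0; pose a' := \row_(i < m) a 0 (lift ord0 i).
rewrite ge0_integral_powerS// ge0_integral_powerS; last 2 first.
- exact: measurable_shift_weight.
- by move=> t; rewrite mule_ge0// lee_fin expR_ge0.
have mFc : measurable_fun setT
   (fun p : measurableTypeR R * m.-tuple RT => F [tuple of p.1 :: p.2]).
  by apply: measurableT_comp => //; exact: measurable_tcons.
have mG : measurable_fun setT (fun x : R => \int[gauss m]_t F [tuple of x :: t])%E.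
  exact: (measurable_fun_fubini_tonelli_F _ mFc).
rewrite (ge0_integral_normal_shift a0 mG); last first.
  by move=> x; exact: integral_ge0.
apply: eq_integral => x _.
rewrite (IH a'); last 2 first.
- exact: (measurableT_comp mF (mcons (x + a0))).
- by [].
rewrite -ge0_integralZr//; last 2 first.
- apply: (measurable_shift_weight a' (F := fun t => F [tuple of x + a0 :: t])).
  exact: (measurableT_comp mF (mcons (x + a0))).
- by move=> t _; rewrite mule_ge0// lee_fin expR_ge0.
apply: eq_integral => t _.
rewrite -muleA -EFinM -expRD; congr (F _ * (expR _)%:E)%E.
- apply: eq_from_tnth => i; rewrite tnth_mktuple.
  case: (unliftP ord0 i) => [j ->|->].
    by rewrite !tnthS tnth_mktuple mxE.
  by rewrite !tnth0.
- rewrite /dotr !big_ord_recl !mxE tnth0.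
  under [X in - (_ + X)]eq_bigr do rewrite mxE tnthS.
  under [X in - X - _ + _]eq_bigr do rewrite !mxE.
  under [X in _ - X / 2 + _]eq_bigr do rewrite !mxE.
  by rewrite -/a0; field.
Qed.

(** Shifting the constant 1 by [- a] shows that exp(<a, t> - |a|^2 / 2) has integral 1. *)
Lemma gauss_mgf m (a : 'rV[R]_m) :
  (\int[gauss m]_t (expR (dotr a (row_of t)))%:E = (expR (dotr a a / 2))%:E)%E.
Proof.
have H0 := @ge0_integral_gauss_shift m (- a) (fun=> 1%E) (measurable_cst _) (fun=> lee01).
rewrite integral_cst// [X in (_ * X)%E]probability_setT mul1e in H0.
have H : (1 = \int[gauss m]_t
    ((expR (- (dotr a a / 2)))%:E * (expR (dotr a (row_of t)))%:E))%E.
  rewrite [LHS]H0; apply: eq_integral => t _.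
  rewrite mul1e -EFinM -expRD !dotrNl dotrNr; congr (expR _)%:E; ring.
rewrite ge0_integralZl// in H.
- have -> : ((expR (dotr a a / 2))%:E = (expR (dotr a a / 2))%:E * 1)%E by rewrite mule1.
  by rewrite H muleA -EFinM -expRD subrr expR0 mul1e.
- apply/measurable_EFinP/measurableT_comp => //; exact: measurable_dotr.
Qed.

End gauss.

(** * Moments of Gaussian linear forms and the entropy bound *)

Section gauss_real.
Context {R : realType}.
Variable m : nat.
Implicit Types a w : 'rV[R]_m.
Local Notation RT := (measurableTypeR R).
Local Notation G := (@gauss R m).
Local Notation lin a := (fun t : m.-tuple RT => dotr a (row_of t)).

Lemma integrable_gauss_expR a : G.-integrable setT (EFin \o (fun t => expR (dotr a (row_of t)))).
Proof.
apply/integrableP; split.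
  by apply/measurable_EFinP/measurableT_comp => //; exact: measurable_dotr.
under eq_integral => t _ do rewrite /= ger0_norm ?expR_ge0//.
by rewrite gauss_mgf ltry.
Qed.

Lemma Rintegral_gauss_expR a : \int[G]_t expR (dotr a (row_of t)) = expR (dotr a a / 2).
Proof. by rewrite /Rintegral gauss_mgf. Qed.

Lemma integrable_gauss_dotr_sqr a :
  G.-integrable setT (EFin \o (fun t => dotr a (row_of t) ^+ 2)).
Proof.
have i1 := integrable_gauss_expR a; have i2 := integrable_gauss_expR (- a).
apply: (le_integrable _ _ _ (integrableD measurableT i1 i2)) => //.
  apply/measurable_EFinP; apply: measurable_funX; exact: measurable_dotr.
move=> t _ /=; rewrite lee_fin [leLHS]ger0_norm ?sqr_ge0// ger0_norm ?addr_ge0 ?expR_ge0//.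
by rewrite dotrNl (le_trans _ (cosh_ge _))// lerDr.
Qed.

Lemma integrable_gauss_dotr a :
  G.-integrable setT (EFin \o (fun t => dotr a (row_of t))).
Proof.
have i1 := integrable_gauss_dotr_sqr a.
have i2 : G.-integrable setT (EFin \o (fun=> 1)).
  by apply: bmeas_integrable; exact: bmeas_cst.
apply: (le_integrable _ _ _ (integrableD measurableT i1 i2)) => //.
  apply/measurable_EFinP; exact: measurable_dotr.
move=> t _ /=; rewrite lee_fin [leRHS]ger0_norm ?addr_ge0 ?sqr_ge0//.
rewrite -real_normK ?num_real//; move: `|_| (normr_ge0 (dotr a (row_of t))) => x x0.
by have := sqr_ge0 (x - 1 / 2); rewrite !expr2; lra.
Qed.

(** Integrating 1 + s x <= exp(s x) for all real s against the known moment generating function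
    forces the mean to vanish. *)
Lemma Rintegral_gauss_dotr a : \int[G]_t dotr a (row_of t) = 0.
Proof.
have ubd (s : R) : s * \int[G]_t dotr a (row_of t) <= expR (s ^+ 2 * dotr a a / 2) - 1.
  rewrite lerBrDl -(_ : dotr (s *: a) (s *: a) = s ^+ 2 * dotr a a); last first.
    by rewrite dotrZl dotrZr mulrA expr2.
  rewrite -Rintegral_gauss_expR -[X in X + _](Rint_cst G 1).
  rewrite -RintegralZl//; last exact: integrable_gauss_dotr.
  have i1 : G.-integrable setT (EFin \o (fun=> 1 : R)).
    by apply: bmeas_integrable; exact: bmeas_cst.
  have i2 : G.-integrable setT (EFin \o (fun t => s * dotr a (row_of t))).
    exact: (integrableZl measurableT s (integrable_gauss_dotr a)).
  rewrite -RintegralD//; apply: le_Rintegral => //.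
  - exact: (integrableD measurableT i1 i2).
  - exact: integrable_gauss_expR.
  - by move=> t _; rewrite dotrZl expR_ge1Dx.
exact: eq0_of_mgf_bound (dotr_ge0 a) ubd.
Qed.

(** Same method as for the mean, with 2 + s^2 x^2 <= exp(s x) + exp(-s x). *)
Lemma Rintegral_gauss_dotr_sqr a : \int[G]_t (dotr a (row_of t) ^+ 2) <= dotr a a.
Proof.
have ubd (s : R) : 2 + s ^+ 2 * \int[G]_t (dotr a (row_of t) ^+ 2)
    <= 2 * expR (s ^+ 2 * dotr a a / 2).
  rewrite -(_ : dotr (s *: a) (s *: a) = s ^+ 2 * dotr a a); last first.
    by rewrite dotrZl dotrZr mulrA expr2.
  rewrite (_ : 2 * expR _ = expR (dotr (s *: a) (s *: a) / 2) +
      expR (dotr (- (s *: a)) (- (s *: a)) / 2)); last first.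
    by rewrite dotrNl dotrNr opprK; ring.
  rewrite -!Rintegral_gauss_expR -[X in X + _](Rint_cst G 2).
  rewrite -RintegralZl//; last exact: integrable_gauss_dotr_sqr.
  have i1 : G.-integrable setT (EFin \o (fun=> 2 : R)).
    by apply: bmeas_integrable; exact: bmeas_cst.
  have i2 : G.-integrable setT (EFin \o (fun t => s ^+ 2 * dotr a (row_of t) ^+ 2)).
    exact: (integrableZl measurableT _ (integrable_gauss_dotr_sqr a)).
  have i3 := integrable_gauss_expR (s *: a).
  have i4 := integrable_gauss_expR (- (s *: a)).
  rewrite -!RintegralD//; apply: le_Rintegral => //.
  - exact: (integrableD measurableT i1 i2).
  - exact: (integrableD measurableT i3 i4).
  - by move=> t _; rewrite dotrNl dotrZl -exprMn cosh_ge.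
apply: le_of_mgf_bound ubd; first exact: dotr_ge0.
by apply: Rintegral_ge0 => t _; rewrite sqr_ge0.
Qed.

(* Exponential tilting by the Cameron--Martin density followed by Jensen's
   inequality: the Donsker--Varadhan bound for the Gaussian shifted by [w],
   whose relative entropy is [dotr w w / (2 * tau ^+ 2)]. *)
Lemma gauss_donsker_varadhan (tau : R) w (phi : 'rV[R]_m -> R) : 0 < tau ->
  bmeas (fun t : m.-tuple RT => phi (tau *: row_of t)) ->
  bmeas (fun t : m.-tuple RT => phi (w + tau *: row_of t)) ->
  expR (\int[G]_t phi (w + tau *: row_of t) - dotr w w / (2 * tau ^+ 2)) <=
  \int[G]_t expR (phi (tau *: row_of t)).
Proof.
move=> tau0 b0 bw.
set c := _ - _.
pose a := tau^-1 *: w.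
pose y t := phi (w + tau *: row_of t) - dotr a (row_of t) - dotr a a / 2.
have ey : (\int[G]_t (expR (y t))%:E = (\int[G]_t expR (phi (tau *: row_of t)))%:E)%E.
  have be := bmeas_expR b0.
  rewrite EFin_Rint// [RHS](ge0_integral_gauss_shift a).
  - apply: eq_integral => t _; rewrite -EFinM -expRD row_of_shift scalerDr scalerA.
    by rewrite mulfV ?gt_eqF// scale1r (addrC (tau *: _)) addrA.
  - apply/measurable_EFinP; exact: be.1.
  - by move=> t; rewrite lee_fin expR_ge0.
have my : measurable_fun setT y.
  apply: measurable_funB => //; apply: measurable_funB; first exact: bw.1.
  exact: measurable_dotr.
have iy : G.-integrable setT (EFin \o (expR \o y)).
  apply/integrableP; split; first exact/measurable_EFinP/measurableT_comp.
  under eq_integral => t _ do rewrite /= ger0_norm ?expR_ge0//.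
  by rewrite ey ltry.
have i0 := bmeas_integrable G bw.
have id := integrable_gauss_dotr a.
have ik : G.-integrable setT (EFin \o (fun=> 1 - c - dotr a a / 2)).
  by apply: bmeas_integrable; exact: bmeas_cst.
have i1 : G.-integrable setT (EFin \o (fun t => phi (w + tau *: row_of t) - dotr a (row_of t))).
  by have := integrableB measurableT i0 id; apply: eq_integrable => // t _ /=.
have i2 : G.-integrable setT (EFin \o (fun t =>
    phi (w + tau *: row_of t) - dotr a (row_of t) + (1 - c - dotr a a / 2))).
  by have := integrableD measurableT i1 ik; apply: eq_integrable => // t _ /=.
have -> : \int[G]_t expR (phi (tau *: row_of t)) = \int[G]_t expR (y t).
  by rewrite [RHS]/Rintegral ey.
(* [c] is the mean of [y]. The integrand is the tangent of exp at [c], evaluated at [y] and divided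
   by exp(c); that exp lies above this tangent is Jensen's inequality. *)
have -> : expR c = expR c * \int[G]_t
    (phi (w + tau *: row_of t) - dotr a (row_of t) + (1 - c - dotr a a / 2)).
  rewrite RintegralD// RintegralB// Rintegral_gauss_dotr Rint_cst.
  rewrite -[LHS]mulr1; congr (_ * _).
  rewrite /c /a dotrZl dotrZr; field; rewrite gt_eqF//.
rewrite -RintegralZl//; apply: le_Rintegral => //.
  exact: (integrableZl measurableT _ i2).
move=> t _ /=.
have -> : expR (y t) = expR c * expR (y t - c) by rewrite -expRD; congr expR; ring.
rewrite ler_wpM2l ?expR_ge0// (le_trans _ (expR_ge1Dx _))//.
by rewrite /y le_eqVlt; apply/orP; left; apply/eqP; ring.
Qed.

End gauss_real.

(** * Hoeffding's lemma *)

Section hoeffding.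
Context {d} {T : measurableType d} {R : realType}.
Variable P : probability T R.

(** Replacing exp by its chord over [a, b] reduces [u] to a two-point variable with the same mean,
    that is, to [bernoulli_mgf_le] with p = (mu - a) / (b - a). *)
Lemma hoeffding_lemma (u : T -> R) (a b s : R) : bmeas u ->
  (forall x, a <= u x <= b) ->
  \int[P]_x expR (s * (\int[P]_y u y - u x)) <= expR (s ^+ 2 * (b - a) ^+ 2 / 8).
Proof.
move=> bu uab; set mu := \int[P]_y u y.
have bs : bmeas (fun x => s * (mu - u x)).
  by apply: bmeasZ; apply: bmeasB => //; exact: bmeas_cst.
(* A degenerate interval makes [u] constant; it is split off because b - a is a denominator
   below. *)
have [ba|ab] := leP b a.
  have uE x : u x = a.
    by apply/eqP; rewrite eq_le; case/andP: (uab x) => -> /le_trans -> //.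
  have -> : mu = a by rewrite /mu; under eq_Rintegral do rewrite uE; rewrite Rint_cst.
  under eq_Rintegral do rewrite uE subrr mulr0 expR0.
  by rewrite Rint_cst -expR0 ler_expR divr_ge0// mulr_ge0// sqr_ge0.
have c0 : 0 < b - a by rewrite subr_gt0.
have mab : a <= mu <= b.
  by rewrite Rint_ge ?Rint_le// => x; case/andP: (uab x).
have ratio01 x : a <= x <= b -> 0 <= (x - a) / (b - a) <= 1.
  by move=> /andP[ax xb]; rewrite divr_ge0 ?subr_ge0 ?(ltW ab)//= ler_pdivrMr// mul1r lerB.
pose z := - (s * (b - a)).
pose k := expR (s * (mu - a)) * ((expR z - 1) / (b - a)).
have bk : bmeas (fun x => expR (s * (mu - a)) - k * a + k * u x).
  by apply: bmeasD; [exact: bmeas_cst|exact: bmeasZ].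
have chord x : expR (s * (mu - u x)) <= expR (s * (mu - a)) - k * a + k * u x.
  have -> : s * (mu - u x) = s * (mu - a) + (u x - a) / (b - a) * z.
    by rewrite /z; field; rewrite gt_eqF.
  rewrite expRD (le_trans (ler_wpM2l _ (expR_chord_le z (ratio01 _ (uab x))))) ?expR_ge0//.
  by rewrite le_eqVlt; apply/orP; left; apply/eqP; rewrite /k; field; rewrite gt_eqF.
apply: (le_trans (le_Rint P (bmeas_expR bs) bk chord)).
rewrite RintD; [|exact: bmeas_cst|exact: bmeasZ].
rewrite Rint_cst RintZ// -/mu.
have -> : expR (s * (mu - a)) - k * a + k * mu =
    expR (s * (mu - a)) * (1 - (mu - a) / (b - a) + (mu - a) / (b - a) * expR z).
  by rewrite /k; field; rewrite gt_eqF.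
rewrite (le_trans (ler_wpM2l (expR_ge0 _) (bernoulli_mgf_le z (ratio01 _ mab))))//.
rewrite -expRD ler_expR le_eqVlt; apply/orP; left; apply/eqP.
by rewrite /z; field; rewrite gt_eqF.
Qed.

End hoeffding.

(** * Gaussian smoothing of families that are Lipschitz in the parameter *)

Section lipschitz_family.
Context {R : realType} {m : nat}.
Local Notation RT := (measurableTypeR R).

(** The l1 distance suits coordinatewise rational approximation. Lipschitz constants with respect to
    it never enter the final bound, so their size is immaterial. *)
Definition dist1 (v w : 'rV[R]_m) : R := \sum_i `|v 0 i - w 0 i|.

Lemma dist1_addr (v w x : 'rV[R]_m) : dist1 (v + x) (w + x) = dist1 v w.
Proof. by apply: eq_bigr => i _; rewrite !mxE opprD addrACA subrr addr0. Qed.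

Lemma dist1_ge0 v w : 0 <= dist1 v w.
Proof. by apply: sumr_ge0. Qed.

(** Rounding towards zero keeps the rational weights inside the Frobenius ball. *)
Lemma rat_approx_inward (x e : R) : 0 < e ->
  exists q : rat, `|x - ratr q| < e /\ `|ratr q| <= `|x|.
Proof.
have pos y : 0 < y -> 0 < e -> exists q : rat, `|y - ratr q| < e /\ `|ratr q| <= `|y|.
  move=> y0 e0; have [|q] := @rat_in_itvoo R (Num.max 0 (y - e)) y.
    by rewrite gt_max y0 gtrBl.
  rewrite in_itv/= gt_max => /andP[/andP[q0 yq] qy]; exists q; split.
    by rewrite ltr_distlC yq (lt_trans qy)// ltrDl.
  by rewrite !gtr0_norm// ltW.
move=> e0; have [x0|x0|->] := ltgtP x 0; last 2 first.
- exact: pos.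
- by exists 0; rewrite rmorph0 subrr normr0.
have [|q [h1 h2]] := pos (- x) _ e0; first by rewrite oppr_gt0.
exists (- q); rewrite rmorphN opprK !normrN; split; last by rewrite -(normrN x).
by move: h1; rewrite -opprD normrN.
Qed.

Lemma dist1_rat_dense (v : 'rV[R]_m) (e : R) : 0 < e ->
  exists2 q : 'rV[rat]_m, dist1 v (map_mx ratr q) < e
    & forall i, `|map_mx ratr q 0 i| <= `|v 0 i|.
Proof.
move=> e0.
(* Dividing by m + 1 covers m = 0 and keeps the total error, a sum of m terms, strictly below e. *)
have e'0 : 0 < e / m.+1%:R by rewrite divr_gt0.
pose P i (q : rat) := `|v 0 i - ratr q| < e / m.+1%:R /\ `|ratr q| <= `|v 0 i|.
have H i : P i (xget 0 [set q | P i q]).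
  by have [q hq] := rat_approx_inward (v 0 i) e'0; exact: (xgetPex 0 (ex_intro _ q hq)).
exists (\row_i xget 0 [set q | P i q]); last by move=> i; rewrite !mxE; case: (H i).
apply: (@le_lt_trans _ _ (\sum_(i < m) e / m.+1%:R)).
  by apply: ler_sum => i _; rewrite !mxE; case: (H i) => /ltW.
rewrite sumr_const card_ord -[_ *+ m]mulr_natr -mulrA.
rewrite gtr_pMr// mulrC ltr_pdivrMr// mul1r ltr_nat//.
Qed.

Context {d} {Z : measurableType d}.
Implicit Type u : 'rV[R]_m -> Z -> R.

(** [K] serves joint measurability; the concentration bounds see only the range [a, b]. *)
Definition lipfam (K a b : R) u :=
  [/\ 0 <= K, forall v, measurable_fun setT (u v),
      forall v v' z, `|u v z - u v' z| <= K * dist1 v v'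
    & forall v z, a <= u v z <= b].

(* Being Lipschitz in its parameter, [u] is the infimum over rational [q] of
   [u q z + K * dist1 v q], hence jointly measurable. *)
Lemma measurable_lipfam K a b u d' (T : measurableType d') (c : T -> 'rV[R]_m) (h : T -> Z) :
  lipfam K a b u -> (forall i, measurable_fun setT (fun t => c t 0 i)) ->
  measurable_fun setT h -> measurable_fun setT (fun t => u (c t) (h t)).
Proof.
move=> [K0 mu lu _] mc mh.
move=> mT; apply: (measurability _ (RGenInftyO.measurableE R)) => //.
move=> /= _ [_ [x ->] <-]; rewrite setTI.
have -> : (fun t => u (c t) (h t)) @^-1` `]-oo, x[ =
    \bigcup_(q : 'rV[rat]_m) [set t | u (map_mx ratr q) (h t)
        + K * dist1 (c t) (map_mx ratr q) < x].
  apply/seteqP; split => t /=.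
    rewrite in_itv/= => ux.
    (* Passing to [q] costs K times the distance twice: once in [u], once in the added penalty. *)
    have e0 : 0 < (x - u (c t) (h t)) / (2 * K + 1).
      by rewrite divr_gt0 ?subr_gt0//; lra.
    have [q hq _] := dist1_rat_dense (c t) e0.
    exists q => //=.
    have := lu (c t) (map_mx ratr q) (h t); rewrite ler_norml => /andP[h1 _].
    have : dist1 (c t) (map_mx ratr q) * (2 * K + 1) < x - u (c t) (h t).
      by rewrite -ltr_pdivlMr//; lra.
    have := dist1_ge0 (c t) (map_mx ratr q); lra.
  move=> [q _ /=]; rewrite in_itv/=; apply: le_lt_trans.
  by have := lu (c t) (map_mx ratr q) (h t); rewrite ler_norml => /andP[_]; lra.
apply: countable_bigcupT_measurable => [|q]; first exact: countableP.
rewrite -[X in measurable X]setTI.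
rewrite (_ : [set t | _] = (fun t => u (map_mx ratr q) (h t)
    + K * dist1 (c t) (map_mx ratr q)) @^-1` `]-oo, x[); last first.
  by apply/seteqP; split => t /=; rewrite in_itv.
suff mg : measurable_fun setT (fun t => u (map_mx ratr q) (h t)
    + K * dist1 (c t) (map_mx ratr q)) by apply: mg => //; exact: measurable_itv.
apply: measurable_funD; first exact: measurableT_comp.
apply: measurable_funM => //; apply: measurable_sum => i.
by apply: measurableT_comp => //; exact: measurable_funB.
Qed.

Lemma lipfam_bmeas K a b u d' (T : measurableType d') (c : T -> 'rV[R]_m) (h : T -> Z) :
  lipfam K a b u -> (forall i, measurable_fun setT (fun t => c t 0 i)) ->
  measurable_fun setT h -> bmeas (fun t => u (c t) (h t)).
Proof.
move=> lu mc mh; split; first exact: measurable_lipfam lu mc mh.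
case: lu => _ _ _ uab; exists (Num.max `|a| `|b|) => t.
case/andP: (uab (c t) (h t)) => au ub; rewrite ler_norml; apply/andP; split.
  rewrite (le_trans _ au)// lerNl (@le_trans _ _ `|a|)//.
    by rewrite -normrN ler_norm.
  by rewrite le_max lexx.
by rewrite (le_trans ub)// (le_trans (ler_norm _))// le_max lexx orbT.
Qed.

Lemma lipfam_weak K a b a' b' u : lipfam K a b u ->
  (forall v z, a' <= u v z <= b') -> lipfam K a' b' u.
Proof. by case=> K0 mu lu _ h; split. Qed.

Lemma lipfamB K K' a b a' b' u u' : lipfam K a b u -> lipfam K' a' b' u' ->
  lipfam (K + K') (a - b') (b - a') (fun v z => u v z - u' v z).
Proof.
move=> [K0 mu lu ub] [K'0 mu' lu' ub']; split.
- exact: addr_ge0.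
- by move=> v; exact: measurable_funB.
- move=> v v' z; rewrite mulrDl.
  have -> : u v z - u' v z - (u v' z - u' v' z) = (u v z - u v' z) - (u' v z - u' v' z).
    by ring.
  by rewrite (le_trans (ler_normB _ _))// lerD.
- move=> v z; case/andP: (ub v z) => ? ?; case/andP: (ub' v z) => ? ?.
  by rewrite !lerB.
Qed.

Lemma measurable_row_of (v : 'rV[R]_m) (tau : R) i :
  measurable_fun setT (fun t : m.-tuple RT => (v + tau *: row_of t) 0 i).
Proof.
under eq_fun do rewrite !mxE.
apply: measurable_funD => //; apply: measurable_funM => //.
exact: measurable_tnth.
Qed.

Definition gsmooth (tau : R) u v z := \int[gauss m]_t u (v + tau *: row_of t) z.

Section smoothing.
Variables (K a b : R) (u : 'rV[R]_m -> Z -> R).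
Hypothesis lu : lipfam K a b u.

Lemma lipfam_bmeas_param v : bmeas (u v).
Proof. by apply: (lipfam_bmeas (c := fun=> v) lu) => // i; exact: measurable_cst. Qed.

Lemma lipfam_bmeas_noise v tau z : bmeas (fun t : m.-tuple RT => u (v + tau *: row_of t) z).
Proof.
by apply: (lipfam_bmeas (h := fun=> z) lu) => [i|];
  [exact: measurable_row_of|exact: measurable_cst].
Qed.

Lemma lipfam_bmeas_prod v tau :
  bmeas (fun p : m.-tuple RT * Z => u (v + tau *: row_of p.1) p.2).
Proof.
apply: (lipfam_bmeas (h := snd) lu) => // i.
exact: (measurableT_comp (measurable_row_of v tau i) measurable_fst).
Qed.

Lemma lipfam_gsmooth tau : lipfam K a b (gsmooth tau u).
Proof.
case: (lu) => K0 mu Lu ub; split => //.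
- by move=> v; exact: (bmeas_Rint2 (lipfam_bmeas_prod v tau) (gauss m)).1.
- move=> v v' z; rewrite /gsmooth -RintB; [|exact: lipfam_bmeas_noise..].
  apply: normr_Rint_le.
    by apply: bmeasB; exact: lipfam_bmeas_noise.
  by move=> t; rewrite -(dist1_addr v v' (tau *: row_of t)).
- move=> v z; rewrite Rint_ge ?Rint_le//; try exact: lipfam_bmeas_noise.
  + by move=> t; case/andP: (ub (v + tau *: row_of t) z).
  + by move=> t; case/andP: (ub (v + tau *: row_of t) z).
Qed.

Lemma gsmoothC s t v z : gsmooth s (gsmooth t u) v z = gsmooth t (gsmooth s u) v z.
Proof.
pose c (p : m.-tuple RT * m.-tuple RT) := v + s *: row_of p.1 + t *: row_of p.2.
have b1 : bmeas (fun p : m.-tuple RT * m.-tuple RT => u (v + s *: row_of p.1 + t *: row_of p.2) z).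
  apply: (lipfam_bmeas (c := c) (h := fun=> z) lu) => [i|]; last exact: measurable_cst.
  rewrite /c; under eq_fun do rewrite mxE.
  apply: measurable_funD.
    exact: (measurableT_comp (measurable_row_of v s i) measurable_fst).
  have := measurableT_comp (measurable_row_of 0 t i)
    (@measurable_snd _ _ (m.-tuple RT) (m.-tuple RT)).
  by apply: eq_measurable_fun => p _ /=; rewrite add0r.
rewrite /gsmooth (Rint_fubini b1 (gauss m) (gauss m)).
by apply: eq_Rintegral => x _; apply: eq_Rintegral => y _; rewrite addrAC.
Qed.

End smoothing.
End lipschitz_family.

Lemma normal_mgf (R : realType) (a : R) :
  (\int[normal_prob 0 1]_x (expR (a * x))%:E = (expR (a ^+ 2 / 2))%:E)%E.
Proof.
have H0 := @ge0_integral_normal_shift R (- a) (fun=> 1%E) (measurable_cst _) (fun=> lee01).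
rewrite integral_cst// [X in (_ * X)%E]probability_setT mul1e in H0.
have H : (1 = \int[normal_prob 0 1]_x
    ((expR (- (a ^+ 2 / 2)))%:E * (expR (a * x))%:E))%E.
  rewrite [LHS]H0; apply: eq_integral => x _.
  rewrite mul1e -EFinM -expRD; congr (expR _)%:E; ring.
rewrite ge0_integralZl// in H.
- have -> : ((expR (a ^+ 2 / 2))%:E = (expR (a ^+ 2 / 2))%:E * 1)%E by rewrite mule1.
  by rewrite H muleA -EFinM -expRD subrr expR0 mul1e.
- apply/measurable_EFinP/measurableT_comp => //; exact: measurable_funM.
Qed.

Section power_mgf.
Context {d} {T : measurableType d} {R : realType}.
Variables (P : probability T R) (g : T -> R).
Hypothesis bg : bmeas g.

Lemma bmeas_tnth n (i : 'I_n) : bmeas (fun S : n.-tuple T => g (tnth S i)).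
Proof. exact: (bmeas_comp (measurable_tnth i) bg). Qed.

Lemma Rint_power_expR_sum n :
  \int[power P n]_S expR (\sum_(i < n) g (tnth S i)) = (\int[P]_x expR (g x)) ^+ n.
Proof.
have be := bmeas_expR bg.
have bs k : bmeas (fun S : k.-tuple T => expR (\sum_(i < k) g (tnth S i))).
  by apply: bmeas_expR; apply: bmeas_sum => i; exact: bmeas_tnth.
apply: EFin_inj; rewrite EFin_Rint; last exact: bs.
elim: n => [|n IH].
  rewrite integral_power0; last by apply/measurable_EFinP; exact: (bs _).1.
  by rewrite big_ord0 expR0.
rewrite ge0_integral_powerS; last 2 first.
- by apply/measurable_EFinP; exact: (bs _).1.
- by move=> t; rewrite lee_fin expR_ge0.
under eq_integral => x _.
  under eq_integral => t _.
    rewrite big_ord_recl tnth0 expRD EFinM.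
    under eq_bigr => i _ do rewrite tnthS.
    over.
  rewrite ge0_integralZl//; last by apply/measurable_EFinP; exact: (bs _).1.
  rewrite IH muleC.
  over.
rewrite ge0_integralZl//; last 2 first.
- by apply/measurable_EFinP; exact: be.1.
- by rewrite lee_fin exprn_ge0// Rintegral_ge0// => x _; exact: expR_ge0.
by rewrite -EFin_Rint// -EFinM -exprSr.
Qed.

End power_mgf.

(** * The generalization gap and its exponential moments *)

Section gap.
Context {R : realType} {m : nat} {d} {Z : measurableType d}.
Variables (D : probability Z R) (n : nat).
Hypothesis n0 : (0 < n)%N.
Local Notation RT := (measurableTypeR R).
Local Notation G := (gauss m : probability (m.-tuple RT) R).
Implicit Type u : 'rV[R]_m -> Z -> R.

Let n0R : 0 < n%:R :> R. Proof. by rewrite ltr0n. Qed.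

Definition gap u (v : 'rV[R]_m) (S : n.-tuple Z) : R :=
  \int[D]_z u v z - n%:R^-1 * \sum_(i < n) u v (tnth S i).

Section gap_lemmas.
Variables (K a b : R) (u : 'rV[R]_m -> Z -> R).
Hypothesis lu : lipfam K a b u.

Lemma bmeas_avg v : bmeas (fun S : n.-tuple Z => n%:R^-1 * \sum_(i < n) u v (tnth S i)).
Proof.
apply: bmeasZ; apply: bmeas_sum => i; apply: bmeas_tnth.
exact: lipfam_bmeas_param lu _.
Qed.

Lemma avg_bound v (S : n.-tuple Z) : a <= n%:R^-1 * \sum_(i < n) u v (tnth S i) <= b.
Proof.
case: lu => _ _ _ ub.
rewrite mulrC ler_pdivrMr// ler_pdivlMr// !mulr_natr.
rewrite -[n in a *+ n]card_ord -[n in b *+ n]card_ord -!sumr_const.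
by apply/andP; split; apply: ler_sum => i _; case/andP: (ub v (tnth S i)).
Qed.

Lemma lipfam_gap : lipfam (K + K) (a - b) (b - a) (gap u).
Proof.
have [K0 mu Lu ub] := lu; split.
- exact: addr_ge0.
- by move=> v; apply: measurable_funB => //; exact: (bmeas_avg v).1.
- move=> v v' S; rewrite /gap mulrDl.
  have bv w := lipfam_bmeas_param lu w.
  have -> : \int[D]_z u v z - n%:R^-1 * (\sum_(i < n) u v (tnth S i)) -
      (\int[D]_z u v' z - n%:R^-1 * (\sum_(i < n) u v' (tnth S i))) =
      \int[D]_z (u v z - u v' z) -
        n%:R^-1 * \sum_(i < n) (u v (tnth S i) - u v' (tnth S i)).
    by rewrite RintB// sumrB; ring.
  rewrite (le_trans (ler_normB _ _))// lerD//.
    by apply: normr_Rint_le => //; exact: bmeasB.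
  rewrite normrM gtr0_norm ?invr_gt0// mulrC ler_pdivrMr// mulr_natr.
  rewrite (le_trans (ler_norm_sum _ _ _))//.
  by rewrite -[n in _ *+ n]card_ord -sumr_const; apply: ler_sum.
- move=> v S; have /andP[h1 h2] := avg_bound v S.
  have bv := lipfam_bmeas_param lu v.
  have h3 : a <= \int[D]_z u v z by apply: Rint_ge => // z; case/andP: (ub v z).
  have h4 : \int[D]_z u v z <= b by apply: Rint_le => // z; case/andP: (ub v z).
  by rewrite !lerB.
Qed.

Lemma gap_gsmooth tau v S : gap (gsmooth tau u) v S = gsmooth tau (gap u) v S.
Proof.
rewrite /gap /gsmooth.
have bp := lipfam_bmeas_prod lu v tau.
rewrite RintB; last 2 first.
- exact: (bmeas_Rint bp D).
- apply: bmeasZ; apply: bmeas_sum => i; exact: lipfam_bmeas_noise lu _ _ _.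
rewrite -(Rint_fubini bp) RintZ; last first.
  by apply: bmeas_sum => i; exact: lipfam_bmeas_noise lu _ _ _.
by rewrite Rint_sum// => i; exact: lipfam_bmeas_noise lu _ _ _.
Qed.

(** The exponent is a sum of n independent terms, each treated by Hoeffding's lemma with parameter s
    / n. *)
Lemma gap_mgf_le (s : R) v :
  \int[power D n]_S expR (s * gap u v S) <= expR (s ^+ 2 * (b - a) ^+ 2 / (8 * n%:R)).
Proof.
have [K0 mu Lu ub] := lu.
set mu0 := \int[D]_z u v z.
pose g z := s / n%:R * (mu0 - u v z).
have bv := lipfam_bmeas_param lu v.
have bg : bmeas g by apply: bmeasZ; apply: bmeasB => //; exact: bmeas_cst.
have gE S : s * gap u v S = \sum_(i < n) g (tnth S i).
  rewrite /g -mulr_sumr sumrB sumr_const card_ord -mulr_natr /gap -/mu0.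
  by field; rewrite gt_eqF.
under eq_Rintegral => S _ do rewrite gE.
rewrite (Rint_power_expR_sum D bg).
have h := hoeffding_lemma D (s / n%:R) bv (ub v).
rewrite (le_trans (lerXn2r _ _ _ h)) ?nnegrE ?expR_ge0//.
  by apply: Rintegral_ge0 => z _; exact: expR_ge0.
rewrite -expRM_natl ler_expR le_eqVlt; apply/orP; left; apply/eqP.
by field; rewrite gt_eqF.
Qed.

Lemma measurable_scaled_row (tau : R) i :
  measurable_fun setT (fun t : m.-tuple RT => (tau *: row_of t) 0 i).
Proof.
have := measurable_row_of 0 tau i; apply: eq_measurable_fun => t _.
by rewrite add0r.
Qed.

Lemma bmeas_gap_prod tau :
  bmeas (fun p : m.-tuple RT * n.-tuple Z => gap u (tau *: row_of p.1) p.2).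
Proof.
apply: (lipfam_bmeas (h := snd) lipfam_gap) => // i.
exact: (measurableT_comp (measurable_scaled_row tau i) measurable_fst).
Qed.

Lemma bmeas_gap_noise tau S : bmeas (fun t : m.-tuple RT => gap u (tau *: row_of t) S).
Proof.
exact: (bmeas_section2 (f := fun t S => gap u (tau *: row_of t) S) (bmeas_gap_prod tau)).
Qed.

(* Posterior averages of [phi (gap u)] are controlled, simultaneously for all
   posterior means [w], by this single exponential moment under the prior. *)
Definition prior_mgf (phi : R -> R) tau (S : n.-tuple Z) : R :=
  \int[G]_t expR (phi (gap u (tau *: row_of t) S)).

Section prior_mgf_lemmas.
Variable phi : R -> R.
Hypothesis bphi : forall d' (T : measurableType d') (f : T -> R), bmeas f -> bmeas (phi \o f).

Lemma bmeas_prior_mgf tau : bmeas (prior_mgf phi tau).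
Proof.
by apply: bmeas_Rint2; apply: bmeas_expR; exact: (bphi (bmeas_gap_prod tau)).
Qed.

Lemma prior_mgf_ge0 tau S : 0 <= prior_mgf phi tau S.
Proof. by apply: Rintegral_ge0 => t _; exact: expR_ge0. Qed.

(** The prior does not depend on the sample, so Fubini moves the expectation over S inside, where
    the weights are fixed. *)
Lemma Rint_prior_mgf_le tau X :
  (forall v, \int[power D n]_S expR (phi (gap u v S)) <= X) ->
  \int[power D n]_S prior_mgf phi tau S <= X.
Proof.
move=> hX; have b1 := bmeas_expR (bphi (bmeas_gap_prod tau)).
rewrite /prior_mgf -(Rint_fubini b1) /=.
by apply: Rint_le => //; exact: (bmeas_Rint b1).
Qed.

Lemma prior_mgf_posterior tau w S X : 0 < tau -> 0 < X -> prior_mgf phi tau S <= X ->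
  \int[G]_t phi (gap u (w + tau *: row_of t) S) <= dotr w w / (2 * tau ^+ 2) + ln X.
Proof.
move=> tau0 X0 hX.
have h := gauss_donsker_varadhan (phi := fun v => phi (gap u v S)) (w := w) tau0
  (bphi (bmeas_gap_noise tau S)) (bphi (lipfam_bmeas_noise lipfam_gap w tau S)).
have := le_trans h hX.
by rewrite -[X in _ <= X](lnK (_ : X \in Num.pos)) ?posrE// ler_expR lerBlDl.
Qed.

End prior_mgf_lemmas.

Lemma bmeas_mull (c : R) d' (T : measurableType d') (f : T -> R) :
  bmeas f -> bmeas ((fun x => c * x) \o f).
Proof. exact: bmeasZ. Qed.

Lemma bmeas_mull_sqr (c k : R) d' (T : measurableType d') (f : T -> R) :
  bmeas f -> bmeas ((fun x => c * (x / k) ^+ 2) \o f).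
Proof.
move=> bf; apply: bmeasZ; under eq_fun do rewrite expr2.
by apply: bmeasM; apply: bmeasM => //; exact: bmeas_cst.
Qed.

End gap_lemmas.
End gap.

(** * PAC-Bayes bounds at a single scale *)

Section pac_bayes.
Context {R : realType} {m : nat} {d} {Z : measurableType d}.
Variables (D : probability Z R) (n : nat).
Hypothesis n0 : (0 < n)%N.
Local Notation RT := (measurableTypeR R).
Local Notation G := (gauss m : probability (m.-tuple RT) R).
Implicit Type u : 'rV[R]_m -> Z -> R.

Let n0R : 0 < n%:R :> R. Proof. by rewrite ltr0n. Qed.

Section linear.
Variables (K a b c : R) (u : 'rV[R]_m -> Z -> R).
Hypothesis lu : lipfam K a b u.
Hypothesis bac : b - a = c.

(* The rate optimal for the complexity budget [s ^+ 2]. When [c = 0] it is [0]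
   (as [x / 0 = 0]), and the gap vanishes anyway. *)
Definition pb_rate (s : R) := 2 * Num.sqrt (2 * n%:R) * s / c.

(** [pb_rate s] is the rate for which Hoeffding's exponent rate^2 c^2 / (8 n) equals s^2. *)
Lemma Rint_pb_linear_le tau s :
  \int[power D n]_S prior_mgf D u (fun x => pb_rate s * x) tau S <= expR (s ^+ 2).
Proof.
apply: (Rint_prior_mgf_le n0 lu (bmeas_mull (pb_rate s))) => v.
rewrite (le_trans (gap_mgf_le D n0 lu (pb_rate s) v))// ler_expR bac /pb_rate.
have [->|c0] := eqVneq c 0; first by rewrite expr0n/= mulr0 mul0r sqr_ge0.
have sq : Num.sqrt (2 * n%:R) ^+ 2 = 2 * n%:R :> R by rewrite sqr_sqrtr// mulr_ge0// ltW.
rewrite (_ : _ / _ = Num.sqrt (2 * n%:R) ^+ 2 / (2 * n%:R) * s ^+ 2); last first.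
  by field; rewrite c0 gt_eqF.
by rewrite sq mulfV ?mul1r// gt_eqF// mulr_gt0.
Qed.

(** Entropy and confidence together cost at most one s^2, the exponential moment another; 2 s^2
    divided by [pb_rate s] is s c / sqrt(2 n). *)
Lemma pb_linear_bound tau s e w S : 0 < tau -> 0 < s -> 0 < e ->
  prior_mgf D u (fun x => pb_rate s * x) tau S <= expR (s ^+ 2) / e ->
  dotr w w / (2 * tau ^+ 2) + ln e^-1 <= s ^+ 2 ->
  gsmooth tau (gap D (n := n) u) w S <= s * c / Num.sqrt (2 * n%:R).
Proof.
move=> tau0 s0 e0 hP hs.
have lg := lipfam_gap D n0 lu.
have [K0 _ _ ub] := lu.
have c0 : 0 <= c.
  have /andP[h1 h2] := ub 0 point.
  by rewrite -bac subr_ge0 (le_trans h1).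
have sq0 : 0 < Num.sqrt (2 * n%:R) :> R by rewrite sqrtr_gt0 mulr_gt0.
have sq : Num.sqrt (2 * n%:R) ^+ 2 = 2 * n%:R :> R by rewrite sqr_sqrtr// mulr_ge0// ltW.
have [c00|cn0] := eqVneq c 0.
  have [_ _ _ /(_ w S)] := lipfam_gsmooth lg tau.
  by rewrite bac c00 mulr0 mul0r => /andP[].
have cp : 0 < c by rewrite lt_neqAle eq_sym cn0.
have r0 : 0 < pb_rate s by rewrite /pb_rate divr_gt0// !mulr_gt0.
have X0 : 0 < expR (s ^+ 2) / e by rewrite divr_gt0 ?expR_gt0.
have := prior_mgf_posterior n0 lu (phi := fun x => pb_rate s * x)
  (bmeas_mull (pb_rate s)) w tau0 X0 hP.
rewrite RintZ; last exact: lipfam_bmeas_noise lg _ _ _.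
rewrite -/(gsmooth tau (gap D (n := n) u) w S) lnM ?posrE ?invr_gt0 ?expR_gt0// expRK => h.
have h2 : pb_rate s * gsmooth tau (gap D (n := n) u) w S <= 2 * s ^+ 2 by lra.
rewrite -(ler_pM2l r0) (le_trans h2)// /pb_rate le_eqVlt; apply/orP; left; apply/eqP.
by field; rewrite cn0 gt_eqF.
Qed.

(** With the square no rate has to be chosen, so the bound adapts to each posterior mean. The factor
    n - 1 instead of n keeps the Gaussian integral in [gap_sqr_mgf_le] finite. *)
Definition pb_sqr (x : R) := 2 * (n%:R - 1) * (x / c) ^+ 2.

(* Linearise the square in the exponent by an independent standard Gaussian. *)
Lemma gap_sqr_mgf_le v :
  \int[power D n]_S expR (pb_sqr (gap D u v S)) <= Num.sqrt n%:R.
Proof.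
have n1 : 0 <= n%:R - 1 :> R by rewrite subr_ge0 ler1n.
pose k := 2 * Num.sqrt (n%:R - 1) / c.
have bg : bmeas (gap D (n := n) u v).
  exact: lipfam_bmeas_param (lipfam_gap D n0 lu) v.
have bS x : bmeas (fun S => expR (k * x * gap D (n := n) u v S)).
  by apply: bmeas_expR; exact: bmeasZ.
have bsq : bmeas (fun S => expR (pb_sqr (gap D (n := n) u v S))).
  by apply: bmeas_expR; exact: (bmeas_mull_sqr (2 * (n%:R - 1)) c bg).
rewrite -lee_fin EFin_Rint//.
under eq_integral => S _.
  rewrite (_ : pb_sqr _ = (k * gap D u v S) ^+ 2 / 2); last first.
    rewrite /pb_sqr /k.
    rewrite [RHS](_ : _ = 2 * Num.sqrt (n%:R - 1) ^+ 2 * (gap D u v S / c) ^+ 2); last first.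
      by rewrite mulrAC; move: c^-1 => ci; field.
    by rewrite sqr_sqrtr.
  rewrite -normal_mgf.
  over.
have mj : measurable_fun setT (fun p : n.-tuple Z * RT => (expR (k * gap D u v p.1 * p.2))%:E).
  apply/measurable_EFinP/measurableT_comp => //; apply: measurable_funM => //.
  by apply: measurable_funM => //; exact: (measurableT_comp bg.1 measurable_fst).
have j0 p : (0 <= (fun p : n.-tuple Z * RT => (expR (k * gap D u v p.1 * p.2))%:E) p)%E.
  by rewrite lee_fin expR_ge0.
rewrite (@fubini_tonelli _ _ _ _ R (power D n) (normal_prob 0 1) _ mj j0).
(* Hoeffding bounds the inner integral by exp(q x^2 / 2), whose Gaussian integral is (1 - q)^(-1/2)
   = sqrt n. *)
pose q := (n%:R - 1) / n%:R : R.
apply: (@le_trans _ _ (\int[normal_prob 0 1]_x (expR (q / 2 * x ^+ 2))%:E)%E).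
  apply: ge0_le_integral => //.
  - by move=> x _; apply: integral_ge0 => S _; exact: (j0 (S, x)).
  - exact: measurable_fun_fubini_tonelli_G mj j0.
  - apply/measurable_EFinP/measurableT_comp => //; exact: measurable_funM.
  - move=> x _ /=.
    under eq_integral => S _ do rewrite mulrAC.
    rewrite -EFin_Rint// lee_fin (le_trans (gap_mgf_le D n0 lu (k * x) v))// ler_expR.
    rewrite bac /k.
    have [->|cn0] := eqVneq c 0.
      by rewrite expr0n/= mulr0 mul0r /q mulr_ge0 ?sqr_ge0// !divr_ge0// ltW.
    rewrite [leLHS](_ : _ = Num.sqrt (n%:R - 1) ^+ 2 / (2 * n%:R) * x ^+ 2); last first.
      by field; rewrite cn0 gt_eqF.
    rewrite sqr_sqrtr// /q le_eqVlt; apply/orP; left; apply/eqP.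
    by field; rewrite gt_eqF.
have q01 : 0 <= q < 1.
  by rewrite /q (divr_ge0 n1 (ltW n0R))/= ltr_pdivrMr// mul1r gtrBl.
rewrite normal_expR_sqr// lee_fin.
have -> : 1 - q = n%:R^-1 by rewrite /q; field; rewrite gt_eqF.
by rewrite sqrtrV ?invrK// ltW.
Qed.

Lemma Rint_pb_sqr_le tau :
  \int[power D n]_S prior_mgf D u pb_sqr tau S <= Num.sqrt n%:R.
Proof.
apply: (Rint_prior_mgf_le n0 lu (bmeas_mull_sqr (2 * (n%:R - 1)) c)) => v.
exact: gap_sqr_mgf_le.
Qed.

(** The posterior average of the square dominates the square of the posterior average, by
    [sqr_Rint_le]; the square root then gives the bound. *)
Lemma pb_sqr_bound tau X w S : (1 < n)%N -> 0 < tau -> 0 < X ->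
  prior_mgf D u pb_sqr tau S <= X ->
  gsmooth tau (gap D (n := n) u) w S <=
  c * Num.sqrt ((dotr w w / (2 * tau ^+ 2) + ln X) / (2 * (n%:R - 1))).
Proof.
move=> n1 tau0 X0 hP.
have lg := lipfam_gap D n0 lu.
have [K0 _ _ ub] := lu.
have c0 : 0 <= c.
  have /andP[h1 h2] := ub 0 point.
  by rewrite -bac subr_ge0 (le_trans h1).
have n1R : 0 < 2 * (n%:R - 1) :> R by rewrite mulr_gt0// subr_gt0 ltr1n.
have [c00|cn0] := eqVneq c 0.
  have [_ _ _ /(_ w S)] := lipfam_gsmooth lg tau.
  by rewrite bac c00 mul0r => /andP[].
have cp : 0 < c by rewrite lt_neqAle eq_sym cn0.
have bsq : forall d' (T : measurableType d') (f : T -> R), bmeas f -> bmeas (pb_sqr \o f).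
  by move=> *; exact: bmeas_mull_sqr.
have h := prior_mgf_posterior n0 lu bsq w tau0 X0 hP.
have bn := lipfam_bmeas_noise lg w tau S.
have := sqr_Rint_le G bn.
rewrite -/(gsmooth tau (gap D (n := n) u) w S); set g := gsmooth _ _ _ _ => hg.
have bn2 : bmeas (fun t : m.-tuple RT => gap D u (w + tau *: row_of t) S ^+ 2).
  by under eq_fun do rewrite expr2; exact: bmeasM.
have h' : 2 * (n%:R - 1) / c ^+ 2 * g ^+ 2 <= dotr w w / (2 * tau ^+ 2) + ln X.
  apply: le_trans h.
  have -> : \int[G]_t pb_sqr (gap D u (w + tau *: row_of t) S) =
      2 * (n%:R - 1) / c ^+ 2 * \int[G]_t (gap D u (w + tau *: row_of t) S ^+ 2).
    rewrite -RintZ//; apply: eq_Rintegral => t _.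
    by rewrite /pb_sqr; field.
  by rewrite ler_wpM2l// divr_ge0 ?sqr_ge0// ltW.
rewrite mulrC -ler_pdivrMr// (le_trans (ler_norm _))// -sqrtr_sqr ler_wsqrtr//.
rewrite ler_pdivlMr//; apply: le_trans h'.
by rewrite le_eqVlt; apply/orP; left; apply/eqP; field.
Qed.

End linear.

Lemma gapB K a b K' a' b' u u' v S : lipfam K a b u -> lipfam K' a' b' u' ->
  gap D (n := n) (fun v z => u v z - u' v z) v S = gap D u v S - gap D u' v S.
Proof.
move=> lu lu'; rewrite /gap RintB ?sumrB; first by ring.
- exact: lipfam_bmeas_param lu v.
- exact: lipfam_bmeas_param lu' v.
Qed.

End pac_bayes.

(** * Chaining over dyadic scales *)

Section chain_real.
Context {R : realType}.

Lemma sum_geom_half_le n : \sum_(k < n) (2 ^- k : R) <= 2.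
Proof.
suff -> : \sum_(k < n) (2 ^- k : R) = 2 - 2 * 2 ^- n.
  by rewrite lerBlDr lerDl mulr_ge0// invr_ge0 exprn_ge0.
elim: n => [|n IH]; first by rewrite big_ord0 expr0 invr1; lra.
rewrite big_ord_recr/= IH exprS invfM mulrA mulfV// mul1r; ring.
Qed.

Lemma ln8V_ge1 (delta : R) : 0 < delta < 1 -> 1 <= ln (8 / delta).
Proof.
move=> /andP[d0 d1].
have h : expR 1 <= (8 : R).
  have := @expR_mulB_le1 R (1 / 2).
  have -> : expR 1 = expR (1 / 2) ^+ 2 :> R by rewrite expr2 -expRD; congr expR; field.
  by have := @expR_gt0 R (1 / 2); move: (expR _) => x x0 ?; nra.
rewrite -ler_expR lnK ?posrE ?divr_gt0// (le_trans h)// ler_pdivlMr//; lra.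
Qed.

Lemma expn4_ge k : (k.+1%:R : R) <= 4 ^+ k.
Proof. by rewrite -natrX ler_nat ltn_expl. Qed.

(** Compares the remainder below the finest scale, of order 4^-n, with the target order 1 / sqrt
    n. *)
Lemma sqrt_le_expn4 n : (Num.sqrt n%:R : R) <= 4 ^+ n.
Proof.
apply: (@le_trans _ _ n.+1%:R); last exact: expn4_ge.
have [n0|] := leP 1 (n%:R : R).
  rewrite (@le_trans _ _ n%:R) ?ler_nat//.
  rewrite -{2}[n%:R](sqr_sqrtr (ler0n R n)) expr2 ler_peMr ?sqrtr_ge0//.
  by rewrite -{1}sqrtr1 ler_wsqrtr.
by rewrite ltrn1 ltnS leqn0 => /eqP ->; rewrite sqrtr0.
Qed.

Variables (n : nat) (B r sigma q : R).
Hypotheses (n0 : (0 < n)%N) (B0 : 0 <= B) (r0 : 0 <= r) (sigma0 : 0 < sigma) (q1 : 1 <= q).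

Definition scale k := sigma / 2 ^+ k.
(** Dominates the square root of r^2 / (2 t^2) + (k+1) q^2, relative entropy plus log inverse
    confidence. Relaxing sqrt(k+1) to 2^k makes the chain sum exactly geometric. *)
Definition pb_radius t k := r / (Num.sqrt 2 * t) + 2 ^+ k * q.

Lemma scale_gt0 k : 0 < scale k.
Proof. by rewrite divr_gt0// exprn_gt0. Qed.

Lemma pb_radius_gt0 t k : 0 < t -> 0 < pb_radius t k.
Proof.
move=> t0; rewrite ltr_wpDl// ?divr_ge0// ?mulr_ge0// ?sqrtr_ge0 ?ltW//.
by rewrite mulr_gt0 ?exprn_gt0// (lt_le_trans _ q1).
Qed.

Lemma pb_radius_sqr_ge t k x : 0 < t -> x <= r ^+ 2 ->
  x / (2 * t ^+ 2) + k.+1%:R * q ^+ 2 <= pb_radius t k ^+ 2.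
Proof.
move=> t0 xr; rewrite /pb_radius sqrrD.
have s2 : 0 < Num.sqrt 2 :> R by rewrite sqrtr_gt0.
have s22 : Num.sqrt 2 ^+ 2 = 2 :> R by rewrite sqr_sqrtr.
have h1 : x / (2 * t ^+ 2) <= (r / (Num.sqrt 2 * t)) ^+ 2.
  by rewrite exprMn exprVn exprMn s22 ler_wpM2r// invr_ge0 mulr_ge0// sqr_ge0.
have h2 : k.+1%:R * q ^+ 2 <= (2 ^+ k * q) ^+ 2.
  rewrite exprMn ler_wpM2r ?sqr_ge0// -exprM mulnC exprM.
  by rewrite (_ : 2 ^+ 2 = 4) ?expn4_ge//; ring.
have h3 : 0 <= r / (Num.sqrt 2 * t) * (2 ^+ k * q) *+ 2.
  rewrite mulrn_wge0// mulr_ge0// ?divr_ge0// ?mulr_ge0 ?exprn_ge0// ?ltW//.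
  exact: lt_le_trans q1.
lra.
Qed.

(** With X and Y as posed below, the k-th summand equals (9/8 X + 5/4 Y / sqrt 2) 2^-k. The sum and
    the remainder are at most 9/4 X + 3 Y, within 2 sqrt 2 X + 4 sqrt 2 Y. *)
Lemma chain_sum_le :
  \sum_(k < n) (pb_radius (scale k.+1) k * (B * scale k ^+ 2) / Num.sqrt (2 * n%:R)
    + pb_radius (scale k) k * (B * scale k.+1 ^+ 2) / Num.sqrt (2 * n%:R))
  + B * scale n ^+ 2 <=
  2 * Num.sqrt 2 * (B * r * sigma / Num.sqrt n%:R)
  + 4 * B * sigma ^+ 2 * (Num.sqrt 2 * q / Num.sqrt n%:R).
Proof.
have s2 : 0 < Num.sqrt 2 :> R by rewrite sqrtr_gt0.
have s22 : Num.sqrt 2 ^+ 2 = 2 :> R by rewrite sqr_sqrtr.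
have sn : 0 < Num.sqrt n%:R :> R by rewrite sqrtr_gt0 ltr0n.
have q0 : 0 < q by exact: lt_le_trans q1.
set N := Num.sqrt n%:R in sn *.
set c := Num.sqrt 2 in s2 s22 *.
have ci : c^-1 = c / 2.
  by apply: (mulfI (lt0r_neq0 s2)); rewrite mulfV ?gt_eqF// mulrA -expr2 s22 mulfV.
have c1 : 7 / 5 <= c by nra.
have c2 : c <= 3 / 2 by nra.
pose X := B * r * sigma / N.
pose Y := B * sigma ^+ 2 * q / N.
have X0 : 0 <= X by rewrite divr_ge0 ?mulr_ge0// ltW.
have Y0 : 0 <= Y by rewrite divr_ge0 ?mulr_ge0 ?sqr_ge0// ltW.
have term k : pb_radius (scale k.+1) k * (B * scale k ^+ 2) / Num.sqrt (2 * n%:R)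
    + pb_radius (scale k) k * (B * scale k.+1 ^+ 2) / Num.sqrt (2 * n%:R) =
    (9 / 8 * X + 5 / 4 * Y / c) * 2 ^- k.
  rewrite sqrtrM// -/c -/N /pb_radius /scale -/c /X /Y exprS.
  have p0 : 0 < 2 ^+ k :> R by rewrite exprn_gt0.
  move: (2 ^+ k) p0 => p p0.
  have -> : r / (c * (sigma / (2 * p))) = c * (r * p / sigma).
    by rewrite invfM ci; field; rewrite !gt_eqF.
  have -> : r / (c * (sigma / p)) = c * (r * p / sigma) / 2.
    by rewrite invfM ci; field; rewrite !gt_eqF.
  by field; rewrite !gt_eqF.
under eq_bigr => k _ do rewrite term.
rewrite -mulr_sumr.
have c3 : 0 <= 9 / 8 * X + 5 / 4 * Y / c.
  have hYc : 0 <= Y / c by rewrite divr_ge0// ltW.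
  by lra.
have h1 := ler_wpM2l c3 (sum_geom_half_le n).
have h2 : B * scale n ^+ 2 <= Y.
  rewrite /scale /Y expr_div_n mulrA -[leRHS]mulrA ler_wpM2l//.
    by rewrite mulr_ge0// sqr_ge0.
  rewrite (@le_trans _ _ N^-1)//; last by rewrite ler_peMl// invr_ge0 ltW.
  rewrite lef_pV2 ?posrE// ?exprn_gt0// ?exprn_gt0// -exprM mulnC exprM.
  by rewrite (_ : 2 ^+ 2 = 4) ?sqrt_le_expn4//; ring.
have h3 : 5 / 4 * Y / c <= Y by rewrite ler_pdivrMr//; nra.
rewrite -/X (_ : 4 * B * sigma ^+ 2 * (c * q / N) = 4 * c * Y); last first.
  by rewrite /Y; field; rewrite gt_eqF.
nra.
Qed.

End chain_real.

Section chain.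
Context {R : realType} {m : nat} {d} {Z : measurableType d}.
Variables (D : probability Z R) (n : nat) (K A' A B r sigma delta : R).
Variable f : 'rV[R]_m -> Z -> R.
Hypotheses (n1 : (1 < n)%N) (lf : lipfam K A' A f) (B0 : 0 <= B) (r0 : 0 <= r).
Hypotheses (sigma0 : 0 < sigma) (delta01 : 0 < delta < 1).
Hypothesis smooth_f : forall t v z, 0 < t ->
  `|gsmooth t f v z - f v z| <= B * t ^+ 2 / 2.

Let n0 : (0 < n)%N. Proof. exact: ltnW. Qed.

(** The gain is the range: its length B t^2 takes the place of A - A' in the linear PAC-Bayes
    bound. *)
Lemma lipfam_sub_gsmooth t : 0 < t ->
  lipfam (K + K) (- (B * t ^+ 2 / 2)) (B * t ^+ 2 / 2)
    (fun v z => f v z - gsmooth t f v z).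
Proof.
move=> t0; apply: lipfam_weak (lipfamB lf (lipfam_gsmooth lf t)) _ => v z.
by rewrite -ler_norml distrC smooth_f.
Qed.

Lemma lipfam_gsmooth_sub t : 0 < t ->
  lipfam (K + K) (- (B * t ^+ 2 / 2)) (B * t ^+ 2 / 2)
    (fun v z => gsmooth t f v z - f v z).
Proof.
move=> t0; apply: lipfam_weak (lipfamB (lipfam_gsmooth lf t) lf) _ => v z.
by rewrite -ler_norml smooth_f.
Qed.

(* Two consecutive scales are compared through the doubly smoothed gap, so that
   no convolution identity for Gaussian measures is needed. *)
Lemma gsmooth_gap_telescope s t w (S : n.-tuple Z) : 0 < s -> 0 < t ->
  gsmooth s (gap D (fun v z => f v z - gsmooth t f v z)) w S
  + gsmooth t (gap D (fun v z => gsmooth s f v z - f v z)) w S =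
  gsmooth s (gap D f) w S - gsmooth t (gap D f) w S.
Proof.
move=> s0 t0.
have lg := lipfam_gap D n0 lf.
have ls := lipfam_gsmooth lf s.
have lt := lipfam_gsmooth lf t.
have lgs := lipfam_gsmooth lg s.
have lgt := lipfam_gsmooth lg t.
rewrite {1 3}/gsmooth.
under eq_Rintegral => x _ do rewrite (gapB D _ _ lf lt) (gap_gsmooth D lf).
under [X in _ + X]eq_Rintegral => x _ do rewrite (gapB D _ _ ls lf) (gap_gsmooth D lf).
rewrite (RintB _ (lipfam_bmeas_noise lg w s S) (lipfam_bmeas_noise lgt w s S)).
rewrite (RintB _ (lipfam_bmeas_noise lgs w t S) (lipfam_bmeas_noise lg w t S)).
by have := gsmoothC lg s t w S; rewrite /gsmooth => ->; ring.
Qed.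

Local Notation q := (Num.sqrt (ln (8 / delta))).
Local Notation tau := (scale sigma).
Local Notation rad t k := (pb_radius r q t k).
Local Notation eps k := ((delta / 8) ^+ k.+1).

Definition mgf_down k := prior_mgf (n := n) D (fun v z => f v z - gsmooth (tau k) f v z)
  (fun x => pb_rate n (B * tau k ^+ 2) (rad (tau k.+1) k) * x) (tau k.+1).

Definition mgf_up k := prior_mgf (n := n) D (fun v z => gsmooth (tau k.+1) f v z - f v z)
  (fun x => pb_rate n (B * tau k.+1 ^+ 2) (rad (tau k) k) * x) (tau k).

Definition mgf_base := prior_mgf (n := n) D f (pb_sqr n (A - A')) sigma.

(** Each exponential moment is divided by a bound on its mean and multiplied by its share of delta:
    delta / 2 for the base, [eps k] for each of the two moments at scale k. All terms are
    nonnegative, so a total below 1 bounds each of them. *)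
Definition mgf_total (S : n.-tuple Z) : R :=
  delta / (2 * n%:R) * mgf_base S +
  \sum_(k < n) (eps k / expR (rad (tau k.+1) k ^+ 2) * mgf_down k S
               + eps k / expR (rad (tau k) k ^+ 2) * mgf_up k S).

Let delta0 : 0 < delta. Proof. by case/andP: delta01. Qed.
Let n0R : 0 < n%:R :> R. Proof. by rewrite ltr0n. Qed.

Let q1 : 1 <= q.
Proof. by rewrite -[leLHS]sqrtr1 ler_wsqrtr// ln8V_ge1. Qed.

Let q2 : q ^+ 2 = ln (8 / delta).
Proof. by rewrite sqr_sqrtr// (le_trans ler01)// ln8V_ge1. Qed.

Let eps0 k : 0 < eps k. Proof. by rewrite exprn_gt0// divr_gt0. Qed.

Let lnV_eps k : ln (eps k)^-1 = k.+1%:R * q ^+ 2.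
Proof.
by rewrite -exprVn invf_div lnXn ?divr_gt0// q2 mulr_natl.
Qed.

Let sum_eps_le : \sum_(k < n) (eps k + eps k) <= delta / 2.
Proof.
have /andP[d0 d1] := delta01.
apply: (@le_trans _ _ (\sum_(k < n) (delta / 4 * 2 ^- k))).
  apply: ler_sum => k _; rewrite exprS -mulrDr.
  have -> : (delta / 8) ^+ k + (delta / 8) ^+ k = 2 * (delta / 8) ^+ k by ring.
  rewrite mulrA (_ : delta / 8 * 2 = delta / 4); last by field.
  rewrite ler_pM2l ?divr_gt0// -exprVn lerXn2r ?nnegrE ?divr_ge0 ?ltW//; lra.
rewrite -mulr_sumr (le_trans (ler_wpM2l _ (sum_geom_half_le n)))//; lra.
Qed.

Lemma bmeas_mgf_down k : bmeas (mgf_down k).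
Proof.
exact: (bmeas_prior_mgf D n0 (lipfam_sub_gsmooth (scale_gt0 sigma0 k)) (bmeas_mull _)).
Qed.

Lemma bmeas_mgf_up k : bmeas (mgf_up k).
Proof.
exact: (bmeas_prior_mgf D n0 (lipfam_gsmooth_sub (scale_gt0 sigma0 k.+1)) (bmeas_mull _)).
Qed.

Lemma bmeas_mgf_base : bmeas mgf_base.
Proof. exact: (bmeas_prior_mgf D n0 lf (bmeas_mull_sqr _ _)). Qed.

Let bmeas_term (k : 'I_n) : bmeas (fun S =>
  eps k / expR (rad (tau k.+1) k ^+ 2) * mgf_down k S +
  eps k / expR (rad (tau k) k ^+ 2) * mgf_up k S).
Proof.
by apply: bmeasD; apply: bmeasZ; [exact: bmeas_mgf_down|exact: bmeas_mgf_up].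
Qed.

Lemma bmeas_mgf_total : bmeas mgf_total.
Proof.
apply: bmeasD; first by apply: bmeasZ; exact: bmeas_mgf_base.
by apply: bmeas_sum => k; exact: bmeas_term.
Qed.

Let term_ge0 (k : nat) S : 0 <= eps k / expR (rad (tau k.+1) k ^+ 2) * mgf_down k S +
  eps k / expR (rad (tau k) k ^+ 2) * mgf_up k S.
Proof.
by rewrite addr_ge0// mulr_ge0 ?prior_mgf_ge0// divr_ge0 ?expR_ge0// ltW.
Qed.

Lemma mgf_total_ge0 S : 0 <= mgf_total S.
Proof.
rewrite addr_ge0//; last by apply: sumr_ge0 => k _; exact: term_ge0.
by rewrite mulr_ge0 ?prior_mgf_ge0// divr_ge0 ?mulr_ge0 ?ltW.
Qed.

Let range_eq t : B * t ^+ 2 / 2 - - (B * t ^+ 2 / 2) = B * t ^+ 2.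
Proof. by field. Qed.

Lemma Rint_mgf_total_le : \int[power D n]_S mgf_total S <= delta.
Proof.
rewrite /mgf_total RintD; last 2 first.
- by apply: bmeasZ; exact: bmeas_mgf_base.
- by apply: bmeas_sum => k; exact: bmeas_term.
rewrite RintZ; last exact: bmeas_mgf_base.
rewrite Rint_sum; last by move=> k; exact: bmeas_term.
apply: (@le_trans _ _ (delta / 2 + delta / 2)); last by rewrite -splitr.
rewrite lerD//.
  have hb := Rint_pb_sqr_le D n0 lf (erefl (A - A')) sigma.
  rewrite -/mgf_base in hb.
  (* The base moment has mean at most sqrt n; relaxing this to n matches ln(2 n / delta) in the
     claim. *)
  apply: (@le_trans _ _ (delta / (2 * n%:R) * n%:R)).
    apply: ler_wpM2l; first by rewrite divr_ge0 ?mulr_ge0 ?ltW.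
    apply: (le_trans hb).
    rewrite -[leRHS](sqr_sqrtr (ler0n R n)) expr2 ler_peMr ?sqrtr_ge0//.
    by rewrite -{1}sqrtr1 ler_wsqrtr// ler1n.
  by rewrite le_eqVlt; apply/orP; left; apply/eqP; field; rewrite gt_eqF.
apply: le_trans sum_eps_le; apply: ler_sum => k _.
rewrite RintD; last 2 first.
- by apply: bmeasZ; exact: bmeas_mgf_down.
- by apply: bmeasZ; exact: bmeas_mgf_up.
rewrite !RintZ; [|exact: bmeas_mgf_up|exact: bmeas_mgf_down].
have weight s X : X <= expR (s ^+ 2) -> eps k / expR (s ^+ 2) * X <= eps k.
  move=> h; rewrite mulrAC ler_pdivrMr ?expR_gt0// ler_wpM2l// ltW//.
rewrite lerD// weight//.
- exact: (Rint_pb_linear_le D n0 (lipfam_sub_gsmooth (scale_gt0 sigma0 k)) (range_eq _)).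
- exact: (Rint_pb_linear_le D n0 (lipfam_gsmooth_sub (scale_gt0 sigma0 k.+1)) (range_eq _)).
Qed.

Lemma gap_le_of_mgf_total (S : n.-tuple Z) w : mgf_total S < 1 -> dotr w w <= r ^+ 2 ->
  gap D f w S <=
  2 * Num.sqrt 2 * (B * r * sigma / Num.sqrt n%:R)
  + 4 * B * sigma ^+ 2 * (Num.sqrt 2 * q / Num.sqrt n%:R)
  + (A - A') * Num.sqrt ((dotr w w / (2 * sigma ^+ 2) + ln (2 * n%:R / delta))
                          / (2 * (n%:R - 1))).
Proof.
move=> hS hw.
have base0 : 0 <= delta / (2 * n%:R) * mgf_base S.
  by rewrite mulr_ge0 ?prior_mgf_ge0// divr_ge0 ?mulr_ge0 ?ltW.
have hbase : mgf_base S <= 2 * n%:R / delta.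
  have : delta / (2 * n%:R) * mgf_base S <= 1.
    apply: le_trans (ltW hS); rewrite /mgf_total lerDl.
    by apply: sumr_ge0 => k _; exact: term_ge0.
  by rewrite -ler_pdivlMl ?divr_gt0 ?mulr_gt0// mulr1 invf_div.
have hterm (k : 'I_n) : eps k / expR (rad (tau k.+1) k ^+ 2) * mgf_down k S
               + eps k / expR (rad (tau k) k ^+ 2) * mgf_up k S <= 1.
  apply: le_trans (ltW hS); rewrite /mgf_total (bigD1 k)//= addrCA lerDl addr_ge0//.
  by apply: sumr_ge0 => j _; exact: term_ge0.
have weight (k : nat) s X : eps k / expR (s ^+ 2) * X <= 1 -> X <= expR (s ^+ 2) / eps k.
  by rewrite -ler_pdivlMl ?divr_gt0 ?expR_gt0// mulr1 invf_div.
have hdown (k : 'I_n) : mgf_down k S <= expR (rad (tau k.+1) k ^+ 2) / eps k.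
  apply: weight; apply: le_trans (hterm k); rewrite lerDl.
  by rewrite mulr_ge0 ?prior_mgf_ge0// divr_ge0 ?expR_ge0// ltW.
have hup (k : 'I_n) : mgf_up k S <= expR (rad (tau k) k ^+ 2) / eps k.
  apply: weight; apply: le_trans (hterm k); rewrite lerDr.
  by rewrite mulr_ge0 ?prior_mgf_ge0// divr_ge0 ?expR_ge0// ltW.
have t0 k := scale_gt0 sigma0 k.
have kl t k : 0 < t -> dotr w w / (2 * t ^+ 2) + ln (eps k)^-1 <= rad t k ^+ 2.
  by move=> tp; rewrite lnV_eps; exact: pb_radius_sqr_ge.
pose F k := gsmooth (tau k) (gap D f) w S.
have step (k : 'I_n) : F k.+1 - F k <=
    rad (tau k.+1) k * (B * tau k ^+ 2) / Num.sqrt (2 * n%:R) +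
    rad (tau k) k * (B * tau k.+1 ^+ 2) / Num.sqrt (2 * n%:R).
  rewrite /F -(gsmooth_gap_telescope w S (t0 k.+1) (t0 k)) lerD//.
  - apply: (pb_linear_bound n0 (lipfam_sub_gsmooth (t0 k)) (range_eq _)
      (t0 k.+1) _ (eps0 k) (hdown k)).
    + exact: pb_radius_gt0.
    + exact: kl.
  - apply: (pb_linear_bound n0 (lipfam_gsmooth_sub (t0 k.+1)) (range_eq _)
      (t0 k) _ (eps0 k) (hup k)).
    + exact: pb_radius_gt0.
    + exact: kl.
(* Below the finest scale no concentration is used, only the range of f minus its smoothing. *)
have rest : gap D f w S - F n <= B * tau n ^+ 2.
  have lt := lipfam_gsmooth lf (tau n).
  rewrite /F -(gap_gsmooth D lf) -(gapB D _ _ lf lt).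
  have [_ _ _ /(_ w S)] := lipfam_gap D n0 (lipfam_sub_gsmooth (t0 n)).
  by rewrite range_eq => /andP[].
have base : F 0%N <= (A - A') * Num.sqrt ((dotr w w / (2 * sigma ^+ 2) + ln (2 * n%:R / delta))
                          / (2 * (n%:R - 1))).
  rewrite /F /scale expr0 divr1.
  apply: (pb_sqr_bound n0 lf (erefl _) _ n1 sigma0 _ hbase).
  by rewrite divr_gt0// mulr_gt0.
have tel : F n - F 0%N <= \sum_(k < n)
    (rad (tau k.+1) k * (B * tau k ^+ 2) / Num.sqrt (2 * n%:R) +
    rad (tau k) k * (B * tau k.+1 ^+ 2) / Num.sqrt (2 * n%:R)).
  rewrite -(telescope_sumr F (leq0n n)) big_mkord; apply: ler_sum => k _; exact: step.
have := chain_sum_le n0 B0 r0 sigma0 q1.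
lra.
Qed.

(** The witness is the complement of {mgf_total >= 1}. It does not mention [w], so one event serves
    all posterior means. *)
Lemma pac_bayes_chain : exists E : set (n.-tuple Z),
  [/\ measurable E, ((1 - delta)%:E <= power D n E)%E &
   forall S w, E S -> dotr w w <= r ^+ 2 -> gap D f w S <=
  2 * Num.sqrt 2 * (B * r * sigma / Num.sqrt n%:R)
  + 4 * B * sigma ^+ 2 * (Num.sqrt 2 * q / Num.sqrt n%:R)
  + (A - A') * Num.sqrt ((dotr w w / (2 * sigma ^+ 2) + ln (2 * n%:R / delta))
                          / (2 * (n%:R - 1)))].
Proof.
have mt := bmeas_mgf_total.
pose E' := [set S | 1 <= mgf_total S].
have mE' : measurable E'.
  rewrite /E' (_ : [set S | _] = mgf_total @^-1` `[1, +oo[); last first.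
    by apply/seteqP; split => S /=; rewrite in_itv/= andbT.
  by rewrite -[X in measurable X]setTI; apply: mt.1 => //; exact: measurable_itv.
exists (~` E'); split.
- exact: measurableC.
- rewrite probability_setC//.
  have h := Rint_markov (power D n) mt mgf_total_ge0.
  have h2 : (power D n E' <= delta%:E)%E.
    by rewrite (le_trans h)// lee_fin Rint_mgf_total_le.
  by rewrite EFinB leeB.
- move=> S w /= /negP; rewrite -ltNge => hS hw; exact: gap_le_of_mgf_total.
Qed.

End chain.

(** * Second order Taylor bound for smooth functions *)

Section taylor.
Context {R : realType} {n : nat}.
Implicit Types (f : 'cV[R]_n -> R) (x h g : 'cV[R]_n).

Definition normsq (h : 'cV[R]_n) : R := \sum_i h i 0 ^+ 2.

Lemma normsq_ge0 h : 0 <= normsq h.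
Proof. by apply: sumr_ge0 => i _; rewrite sqr_ge0. Qed.

Lemma enorm_sqr h : enorm h ^+ 2 = normsq h.
Proof. by rewrite sqr_sqrtr// normsq_ge0. Qed.

Lemma enorm_ge0 h : 0 <= enorm h. Proof. exact: sqrtr_ge0. Qed.

Lemma enormZ (s : R) h : enorm (s *: h) = `|s| * enorm h.
Proof.
rewrite /enorm -sqrtr_sqr -sqrtrM ?sqr_ge0// mulr_sumr; congr Num.sqrt.
by apply: eq_bigr => i _; rewrite mxE exprMn.
Qed.

(** Cauchy--Schwarz through |x y| <= x^2 / (2 c) + c y^2 / 2 in each coordinate; c = 0 forces g = 0
    and is treated apart. *)
Lemma inner_le (c : R) g h : 0 <= c -> enorm g <= c * enorm h ->
  `|\sum_i g i 0 * h i 0| <= c * normsq h.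
Proof.
move=> c0 gh; have [c00|cn0] := eqVneq c 0.
  have g0 : normsq g = 0.
    rewrite -enorm_sqr; apply/eqP; rewrite sqrf_eq0 eq_le enorm_ge0 andbT.
    by rewrite (le_trans gh)// c00 mul0r.
  have gi i : g i 0 = 0.
    apply/eqP; rewrite -sqrf_eq0; move/eqP: g0; rewrite psumr_eq0; last first.
      by move=> j _; rewrite sqr_ge0.
    by move/allP => /(_ i); rewrite mem_index_enum => /(_ isT).
  by rewrite big1 ?normr0 ?c00 ?mul0r// => i _; rewrite gi mul0r.
have cp : 0 < c by rewrite lt_neqAle eq_sym cn0.
have g2 : normsq g <= c ^+ 2 * normsq h.
  by rewrite -!enorm_sqr -exprMn lerXn2r// ?nnegrE ?mulr_ge0 ?enorm_ge0.
apply: (@le_trans _ _ (\sum_i (g i 0 ^+ 2 / (2 * c) + c * h i 0 ^+ 2 / 2))).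
  rewrite (le_trans (ler_norm_sum _ _ _))//; apply: ler_sum => i _.
  rewrite -subr_ge0.
  have E (x y : R) : x ^+ 2 / (2 * c) + c * y ^+ 2 / 2 - `|x * y| =
      (`|x| - c * `|y|) ^+ 2 / (2 * c).
    rewrite normrM -[x ^+ 2]real_normK ?num_real// -[y ^+ 2]real_normK ?num_real//.
    by field.
  by rewrite E divr_ge0 ?sqr_ge0// mulr_ge0 ?ltW.
rewrite big_split/= -mulr_suml -mulr_suml -mulr_sumr -/(normsq g) -/(normsq h).
have : normsq g / (2 * c) <= c ^+ 2 * normsq h / (2 * c).
  by rewrite ler_pM2r// invr_gt0 mulr_gt0.
have -> : c ^+ 2 * normsq h / (2 * c) = c * normsq h / 2 by field.
by lra.
Qed.

Lemma inner_subl g g' h :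
  \sum_i (g - g') i 0 * h i 0 = \sum_i g i 0 * h i 0 - \sum_i g' i 0 * h i 0.
Proof. by rewrite -sumrB; apply: eq_bigr => i _; rewrite !mxE mulrBl. Qed.

Lemma is_derive_line f x h (s : R) : (forall z, differentiable f z) ->
  is_derive s 1 (fun t : R => f (x + t *: h)) (\sum_i gradient f (x + s *: h) i 0 * h i 0).
Proof.
move=> df.
have dfh : derivable f (x + s *: h) h by exact: diff_derivable.
have E : (fun k : R => k^-1 *: (((fun t : R => f (x + t *: h)) \o shift s) (k *: (1 : R))
     - f (x + s *: h)))
   = (fun k : R => k^-1 *: ((f \o shift (x + s *: h)) (k *: h) - f (x + s *: h))).
  apply/funext => k /=; congr (_ *: (f _ - _)).
  by rewrite [k *: 1]mulr1 scalerDl addrCA.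
apply: DeriveDef; first by rewrite /derivable E.
rewrite /derive E -/(derive f (x + s *: h) h) deriveE//.
move: (x + s *: h) => y; rewrite [in LHS](matrix_sum_delta h) linear_sum.
apply: eq_bigr => i _; rewrite big_ord1 linearZ/= mxE deriveE//; exact: mulrC.
Qed.

(** For each sign e, [psi] (the quadratic upper model minus e f along the segment) has nonnegative
    derivative by the Lipschitz gradient; its values at 0 and 1 are compared. *)
Lemma smooth_taylor beta f x h : 0 <= beta -> smooth beta f ->
  `|f (x + h) - f x - \sum_i gradient f x i 0 * h i 0| <= beta / 2 * normsq h.
Proof.
move=> b0 [df lg].
have key (e : R) : `|e| = 1 ->
    e * (f (x + h) - f x - \sum_i gradient f x i 0 * h i 0) <= beta / 2 * normsq h.
  move=> e1.
  pose c := \sum_i gradient f x i 0 * h i 0.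
  pose psi (s : R) := beta / 2 * normsq h * s ^+ 2 + e * c * s - e * f (x + s *: h).
  pose dpsi (s : R) := beta * normsq h * s + e * c
    - e * (\sum_i gradient f (x + s *: h) i 0 * h i 0).
  have dp (s : R) : is_derive s 1 psi (dpsi s).
    have := is_derive_line x h s df => dl.
    rewrite (_ : psi = (fun s : R => beta / 2 * normsq h * s ^+ 2 + e * c * s)
      - (e \*: (fun t : R => f (x + t *: h))))//.
    apply: is_derive_eq; rewrite /dpsi /GRing.scale/=; by field.
  have dp0 s : 0 <= s -> 0 <= dpsi s.
    move=> s0; rewrite /dpsi.
    have bs : 0 <= beta * s by rewrite mulr_ge0.
    have := lg (x + s *: h) x.
    rewrite (_ : x + s *: h - x = s *: h); last by rewrite addrC addKr.
    rewrite enormZ (ger0_norm s0) mulrA => /(inner_le bs); rewrite inner_subl -/c => h2.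
    move: (\sum_i _) h2 => G h2.
    have h3 : e * (G - c) <= beta * s * normsq h.
      by rewrite (le_trans (ler_norm _))// normrM e1 mul1r.
    by lra.
  have := le_of_derive_ge0 dp dp0 (ler01 : 0 <= (1 : R)).
  rewrite /psi scale0r addr0 scale1r expr0n/= expr1n; rewrite -/c; lra.
rewrite ler_norml; apply/andP; split.
  by have := key (-1) (normrN1 _); lra.
by have := key 1 (normr1 _); lra.
Qed.

(** In dimension zero smoothness holds even for negative beta, hence the separate cases C = 0
    below. *)
Lemma smooth_beta_ge0 beta f : (0 < n)%N -> smooth beta f -> 0 <= beta.
Proof.
case: n f => // k f _ [_ lg].
have := lg (delta_mx ord0 0) 0; rewrite subr0.
have -> : enorm (delta_mx ord0 0 : 'cV[R]_k.+1) = 1.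
  rewrite /enorm (bigD1 ord0)//= big1 ?addr0 ?mxE ?eqxx ?expr1n ?sqrtr1// => i i0.
  by rewrite mxE (negbTE i0) expr0n.
by rewrite mulr1; apply: le_trans; exact: sqrtr_ge0.
Qed.

End taylor.

(** * Linear hypotheses with Gaussian weights *)

Section linear_hypotheses.
Context {R : realType} {C d : nat}.
Local Notation RT := (measurableTypeR R).
Local Notation G := (gauss (C * d) : probability ((C * d).-tuple RT) R).
Implicit Types (v : 'rV[R]_(C * d)) (x : 'cV[R]_d).

Lemma sum_mxvec_index (F : 'I_(C * d) -> R) :
  \sum_k F k = \sum_i \sum_j F (mxvec_index i j).
Proof.
rewrite pair_big (reindex _ (curry_mxvec_bij C d))/=.
by apply: eq_bigr => -[i j] _.
Qed.

Lemma vec_mxE v i j : vec_mx v i j = v 0 (mxvec_index i j).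
Proof. by rewrite mxE. Qed.

Lemma dotr_mxvec_frobnorm (W : 'M[R]_(C, d)) : dotr (mxvec W) (mxvec W) = frobnorm W ^+ 2.
Proof.
rewrite sqr_sqrtr; last first.
  by apply: sumr_ge0 => i _; apply: sumr_ge0 => j _; exact: sqr_ge0.
rewrite /dotr sum_mxvec_index; apply: eq_bigr => i _; apply: eq_bigr => j _.
by rewrite mxvecE expr2.
Qed.

(** Represents W -> (W x)_i as an inner product with the flattened weights, so each coordinate of a
    Gaussian W x is a linear form of variance |x|^2. *)
Definition row_probe x (i : 'I_C) : 'rV[R]_(C * d) :=
  mxvec (\matrix_(i' < C, j < d) (x j 0 *+ (i' == i))).

Lemma linhyp_probe v x i : linhyp (vec_mx v) x i 0 = dotr (row_probe x i) v.
Proof.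
rewrite mxE /dotr sum_mxvec_index (bigD1 i)//= [X in _ + X]big1 ?addr0 => [|k ki].
  by apply: eq_bigr => j _; rewrite mxvecE !mxE eqxx mulr1n mulrC.
by apply: big1 => j _; rewrite mxvecE mxE (negbTE ki) mulr0n mul0r.
Qed.

Lemma dotr_probe x i : dotr (row_probe x i) (row_probe x i) = normsq x.
Proof.
rewrite -linhyp_probe mxE; apply: eq_bigr => j _.
by rewrite vec_mxE mxvecE mxE eqxx mulr1n expr2.
Qed.

Lemma linhypD v v' x : linhyp (vec_mx (v + v')) x = linhyp (vec_mx v) x + linhyp (vec_mx v') x.
Proof. by rewrite /linhyp linearD mulmxDl. Qed.

Lemma linhypZ (t : R) v x : linhyp (vec_mx (t *: v)) x = t *: linhyp (vec_mx v) x.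
Proof. by rewrite /linhyp linearZ -scalemxAl. Qed.

Lemma enorm_le_sum n (z : 'cV[R]_n) : enorm z <= \sum_i `|z i 0|.
Proof.
have s0 : 0 <= \sum_i `|z i 0| by apply: sumr_ge0.
rewrite -(ger0_norm s0) -sqrtr_sqr ler_wsqrtr// expr2 mulr_suml.
apply: ler_sum => i _; rewrite -real_normK ?num_real// expr2 ler_wpM2l//.
by rewrite (bigD1 i)//= lerDl; apply: sumr_ge0.
Qed.

Lemma enorm_linhyp_le v v' x :
  enorm (linhyp (vec_mx v) x - linhyp (vec_mx v') x) <= (\sum_j `|x j 0|) * dist1 v v'.
Proof.
rewrite (le_trans (enorm_le_sum _))// /dist1 sum_mxvec_index mulr_sumr.
apply: ler_sum => i _.
have -> : (linhyp (vec_mx v) x - linhyp (vec_mx v') x) i 0 =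
    \sum_j (v 0 (mxvec_index i j) - v' 0 (mxvec_index i j)) * x j 0.
  rewrite !mxE -sumrB; apply: eq_bigr => j _.
  by rewrite !vec_mxE mulrBl.
rewrite (le_trans (ler_norm_sum _ _ _))// mulr_sumr; apply: ler_sum => j _.
rewrite normrM mulrC ler_wpM2r//.
by rewrite (bigD1 j)//= lerDl; apply: sumr_ge0.
Qed.

Lemma Rintegral_sum_integrable dT (T : measurableType dT) (P : probability T R)
    (I : Type) (s : seq I) (F : I -> T -> R) :
  (forall i, P.-integrable setT (EFin \o F i)) ->
  P.-integrable setT (EFin \o (fun t => \sum_(i <- s) F i t)) /\
  \int[P]_t (\sum_(i <- s) F i t) = \sum_(i <- s) \int[P]_t F i t.
Proof.
move=> iF; elim: s => [|i s [IH1 IH2]].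
  rewrite (_ : (fun t => \sum_(i <- [::]) F i t) = fun=> 0); last first.
    by apply/funext => t; rewrite big_nil.
  by rewrite big_nil Rint_cst; split => //; apply: bmeas_integrable; exact: bmeas_cst.
rewrite (_ : (fun t => \sum_(j <- i :: s) F j t) =
    fun t => F i t + \sum_(j <- s) F j t); last by apply/funext => t; rewrite big_cons.
rewrite big_cons RintegralD// IH2; split => //.
exact: (integrableD measurableT (iF i) IH1).
Qed.

(* The first order term of the Taylor expansion is centered under the Gaussian,
   and E |G x|^2 = C |x|^2. *)
Lemma gauss_linhyp_smooth beta (g : 'cV[R]_C -> R) v x (t : R) : smooth beta g ->
  bmeas (fun w : (C * d).-tuple RT => g (linhyp (vec_mx (v + t *: row_of w)) x)) ->
  `|\int[G]_w g (linhyp (vec_mx (v + t *: row_of w)) x) - g (linhyp (vec_mx v) x)|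
    <= beta * C%:R * normsq x * t ^+ 2 / 2.
Proof.
move=> sg bg.
set p := linhyp (vec_mx v) x.
case: (posnP C) => [C0|/smooth_beta_ge0 /(_ sg) b0].
  have cE (y z : 'cV[R]_C) : y = z.
    by apply/colP => i; have := ltn_ord i; rewrite [X in (_ < X)%N]C0.
  under eq_Rintegral => w _ do rewrite (cE (linhyp _ _) p).
  by rewrite Rint_cst subrr normr0 C0 mulr0 !mul0r.
(* The gradient of W -> g(W x) at v, flattened. *)
pose a := \sum_i gradient g p i 0 *: row_probe x i.
have aE (w : 'rV[R]_(C * d)) : dotr a w = \sum_i gradient g p i 0 * linhyp (vec_mx w) x i 0.
  under eq_bigr do rewrite linhyp_probe -dotrZl.
  rewrite /dotr exchange_big/=; apply: eq_bigr => k _.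
  by rewrite summxE mulr_suml.
pose Df (w : (C * d).-tuple RT) :=
  g (linhyp (vec_mx (v + t *: row_of w)) x) - g p - t * dotr a (row_of w).
have bgp : bmeas (fun w : (C * d).-tuple RT => g (linhyp (vec_mx (v + t *: row_of w)) x) - g p).
  by apply: bmeasB => //; exact: bmeas_cst.
have i1 := bmeas_integrable G bgp.
have i2 : G.-integrable setT (EFin \o (fun w => t * dotr a (row_of w))).
  exact: (integrableZl measurableT t (integrable_gauss_dotr a)).
have iD : G.-integrable setT (EFin \o Df) by exact: (integrableB measurableT i1 i2).
have DE : \int[G]_w Df w = \int[G]_w g (linhyp (vec_mx (v + t *: row_of w)) x) - g p.
  rewrite /Df RintegralB// RintegralZl//; last exact: integrable_gauss_dotr.
  by rewrite Rintegral_gauss_dotr mulr0 subr0 RintB ?Rint_cst//; exact: bmeas_cst.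
have iq i : G.-integrable setT (EFin \o (fun w => dotr (row_probe x i) (row_of w) ^+ 2)).
  exact: integrable_gauss_dotr_sqr.
have [isum sumE] := Rintegral_sum_integrable (index_enum 'I_C) iq.
have iU := integrableZl measurableT (beta / 2 * t ^+ 2) isum.
rewrite -DE (le_trans (le_normr_Rintegral _ iD))//.
apply: (@le_trans _ _ (\int[G]_w (beta / 2 * t ^+ 2 *
    \sum_i dotr (row_probe x i) (row_of w) ^+ 2))).
  apply: le_Rintegral => //.
    exact: (integrable_norm iD).
  move=> w _; rewrite /Df linhypD linhypZ -/p.
  have := smooth_taylor p (t *: linhyp (vec_mx (row_of w)) x) b0 sg.
  rewrite aE mulr_sumr.
  rewrite (eq_bigr (fun i => t * (gradient g p i 0 * linhyp (vec_mx (row_of w)) x i 0))).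
    move=> /le_trans; apply.
    rewrite /normsq -[leRHS]mulrA ler_wpM2l ?divr_ge0// mulr_sumr.
    by apply: ler_sum => i _; rewrite mxE exprMn linhyp_probe.
  by move=> i _; rewrite mulrCA; congr (_ * _); rewrite mxE.
rewrite RintegralZl// sumE.
have -> : beta * C%:R * normsq x * t ^+ 2 / 2 = beta / 2 * t ^+ 2 * \sum_(i < C) normsq x.
  by rewrite sumr_const card_ord -[_ *+ C]mulr_natl; field.
apply: ler_wpM2l; first by rewrite mulr_ge0 ?sqr_ge0 ?divr_ge0.
apply: ler_sum => i _.
by rewrite -[leRHS](dotr_probe x i); exact: Rintegral_gauss_dotr_sqr.
Qed.

End linear_hypotheses.

(** * The truncated loss and the uniform bound *)

Section matrix_measurability.
Context {R : realType}.

Lemma measurable_fun_mx_coord m n (i : 'I_m) (j : 'I_n) :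
  measurable_fun setT (fun x : 'M[R]_(m, n) => x i j).
Proof.
move=> _; apply: (measurability _ (RGenOInfty.measurableE R)) => //.
move=> /= _ [_ [x ->] <-]; rewrite setTI.
apply: sub_sigma_algebra => /=.
have /continuousP := @coord_continuous R m n i j; apply.
exact: rray_open.
Qed.

End matrix_measurability.

Section truncation.
Context {R : realType} {dY : measure_display} {Y : measurableType dY} {C d : nat}.
Local Notation Z := ('cV[R]_d * Y)%type.
Local Notation RT := (measurableTypeR R).
Variables (L : 'cV[R]_C -> Y -> R) (A' A l beta M : R).
Hypothesis hL : forall z y, A' <= L z y <= A.
Hypothesis hLip : forall y, elipschitz l (fun z => L z y).
Hypothesis hsmooth : forall y, smooth beta (fun z => L z y).
Hypothesis hmeas : forall W : 'M[R]_(C, d), measurable_fun setT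
     (fun p : 'cV[R]_d * Y => L (linhyp W p.1) p.2).

Definition in_ball : set Z := [set z | normsq z.1 <= M ^+ 2].

(* [D] charges [X] only almost surely and [X] need not be measurable; off the
   ball the loss is frozen, which makes the Lipschitz constant in the weights
   independent of the sample. *)
Definition trunc_loss (v : 'rV[R]_(C * d)) (z : Z) : R :=
  if normsq z.1 <= M ^+ 2 then L (linhyp (vec_mx v) z.1) z.2 else A'.

Let A'A : A' <= A.
Proof. by have /andP[h1 h2] := hL 0 point; exact: le_trans h2. Qed.

Lemma measurable_normsq_fst : measurable_fun setT (fun z : Z => normsq z.1).
Proof.
apply: measurable_sum => i; apply: measurable_funX.
exact: (measurableT_comp (measurable_fun_mx_coord i 0) measurable_fst).
Qed.

Lemma measurable_in_ball : measurable in_ball.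
Proof.
rewrite /in_ball (_ : [set _ | _] = (fun z : Z => normsq z.1) @^-1` `]-oo, M ^+ 2]); last first.
  by apply/seteqP; split => z /=; rewrite in_itv.
by rewrite -[X in measurable X]setTI; apply: measurable_normsq_fst.
Qed.

Lemma measurable_trunc_loss v : measurable_fun setT (trunc_loss v).
Proof.
rewrite /trunc_loss; apply: measurable_fun_ifT => //.
apply: measurable_fun_ler => //; exact: measurable_normsq_fst.
Qed.

Lemma loss_lipschitz (v v' : 'rV[R]_(C * d)) (x : 'cV[R]_d) (y : Y) :
  `|L (linhyp (vec_mx v) x) y - L (linhyp (vec_mx v') x) y| <=
  `|l| * (\sum_j `|x j 0|) * dist1 v v'.
Proof.
rewrite (le_trans (hLip _ _ _))// -mulrA.
apply: (@le_trans _ _ (`|l| * enorm (linhyp (vec_mx v) x - linhyp (vec_mx v') x))).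
  by rewrite ler_wpM2r ?enorm_ge0 ?ler_norm.
by rewrite ler_wpM2l// enorm_linhyp_le.
Qed.

(** On the ball every coordinate of x is at most |M| in absolute value, so its l1 norm is at most d
    |M|. *)
Lemma lipfam_trunc_loss : lipfam (`|l| * (d%:R * `|M|)) A' A trunc_loss.
Proof.
split.
- by rewrite !mulr_ge0.
- exact: measurable_trunc_loss.
- move=> v v' z; rewrite /trunc_loss; case: ifPn => [zM|_]; last first.
    by rewrite subrr normr0 !mulr_ge0 ?dist1_ge0.
  rewrite (le_trans (loss_lipschitz _ _ _ _))// ler_wpM2r ?dist1_ge0// ler_wpM2l//.
  rewrite mulr_natl -[d in _ *+ d]card_ord -sumr_const; apply: ler_sum => j _.
  rewrite -ler_sqr ?nnegrE// !real_normK ?num_real// (le_trans _ zM)//.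
  by rewrite /normsq (bigD1 j)//= lerDl; apply: sumr_ge0 => k _; rewrite sqr_ge0.
- by move=> v z; rewrite /trunc_loss; case: ifP => // _; rewrite lexx.
Qed.

Let B := beta * C%:R * M ^+ 2.

Lemma trunc_curvature_ge0 : 0 <= B.
Proof.
rewrite /B; case: (posnP C) => [->|C0]; first by rewrite mulr0 mul0r.
have b0 := smooth_beta_ge0 C0 (hsmooth point).
by apply: mulr_ge0; [apply: mulr_ge0|exact: sqr_ge0].
Qed.

Lemma gsmooth_trunc_loss t v z : `|gsmooth t trunc_loss v z - trunc_loss v z| <= B * t ^+ 2 / 2.
Proof.
have B0 : 0 <= B * t ^+ 2 / 2 by rewrite divr_ge0// mulr_ge0 ?sqr_ge0// trunc_curvature_ge0.
have bn := lipfam_bmeas_noise lipfam_trunc_loss v t z.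
rewrite /gsmooth; move: bn; rewrite /trunc_loss; case: ifPn => [zM|_] bn; last first.
  by rewrite Rint_cst subrr normr0.
rewrite (le_trans (gauss_linhyp_smooth (hsmooth z.2) bn))//.
rewrite ler_pM2r// ler_wpM2r ?sqr_ge0// /B.
case: (posnP C) => [->|C0]; first by rewrite mulr0 !mul0r.
by rewrite ler_wpM2l// mulr_ge0// (smooth_beta_ge0 C0 (hsmooth point)).
Qed.

Variable D : probability Z R.
Hypothesis D_ball : {ae D, forall z, in_ball z}.

Lemma risk_trunc_loss v :
  risk L D (linhyp (vec_mx v)) = (\int[D]_z trunc_loss v z)%:E.
Proof.
rewrite EFin_Rint; last exact: lipfam_bmeas_param lipfam_trunc_loss v.
rewrite /risk unlock; apply: ae_eq_integral => //.
- by apply/measurable_EFinP; exact: hmeas.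
- by apply/measurable_EFinP; exact: measurable_trunc_loss.
- by apply: filterS D_ball => z zb _; rewrite /trunc_loss zb.
Qed.

Lemma probability_in_ball : D in_ball = 1%E.
Proof.
case: D_ball => N [mN N0 sN].
have mC := measurableC measurable_in_ball.
have C0 : D (~` in_ball) = 0%E by apply: (subset_measure0 mC mN sN N0).
by rewrite -[in_ball]setCK probability_setC// C0 sube0.
Qed.

Definition all_in_ball n : set (n.-tuple Z) := [set S | forall i, in_ball (tnth S i)].

Lemma measurable_all_in_ball n : measurable (@all_in_ball n).
Proof.
rewrite /all_in_ball (_ : [set S | _] = \bigcap_(i in [set: 'I_n])
  ((fun S => tnth S i) @^-1` in_ball)); last first.
  by apply/seteqP; split => S /= h i; [move=> _|]; exact: h.
apply: fin_bigcap_measurable => // i _; rewrite -[X in measurable X]setTI.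
by apply: measurable_tnth => //; exact: measurable_in_ball.
Qed.

Lemma power_all_in_ball n : power D n (~` (@all_in_ball n)) = 0%E.
Proof.
rewrite probability_setC; last exact: measurable_all_in_ball.
rewrite (power_rectangle D (fun=> measurable_in_ball)).
rewrite big1 ?subee// => i _; exact: probability_in_ball.
Qed.

Lemma gap_trunc_loss n v (S : n.-tuple Z) : (forall i, in_ball (tnth S i)) ->
  gap D trunc_loss v S = \int[D]_z trunc_loss v z - emp_risk L S (linhyp (vec_mx v)).
Proof.
move=> bS; rewrite /gap /emp_risk; congr (_ - _ * _); apply: eq_bigr => i _.
by rewrite /trunc_loss (bS i).
Qed.

Lemma measurable_emp_risk n (W : 'M[R]_(C, d)) :
  measurable_fun setT (fun S : n.-tuple Z => emp_risk L S (linhyp W)).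
Proof.
apply: measurable_funM => //; apply: measurable_sum => i.
exact: (measurableT_comp (hmeas W) (measurable_tnth i)).
Qed.

Lemma emp_risk_lipschitz n (S : n.-tuple Z) : exists2 K, 0 <= K & forall v v',
  `|emp_risk L S (linhyp (vec_mx v)) - emp_risk L S (linhyp (vec_mx v'))| <= K * dist1 v v'.
Proof.
exists (n%:R^-1 * \sum_(i < n) `|l| * \sum_j `|(tnth S i).1 j 0|).
  rewrite mulr_ge0 ?invr_ge0//; apply: sumr_ge0 => i _; rewrite mulr_ge0//.
  exact: sumr_ge0.
move=> v v'; rewrite /emp_risk -mulrBr -sumrB normrM ger0_norm ?invr_ge0//.
rewrite -mulrA ler_wpM2l ?invr_ge0// mulr_suml (le_trans (ler_norm_sum _ _ _))//.
by apply: ler_sum => i _; exact: loss_lipschitz.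
Qed.

(* The supremum over all [W] reduces to rational [W]; rounding towards zero
   shrinks [frobnorm], so only monotonicity of the bound [c] is used. *)
Lemma measurable_uniform_bound n (r : R) (c : R -> R) : {homo c : x y / x <= y} ->
  measurable [set S : n.-tuple Z | forall W : 'M[R]_(C, d), frobnorm W <= r ->
    \int[D]_z trunc_loss (mxvec W) z <= emp_risk L S (linhyp W) + c (frobnorm W ^+ 2)].
Proof.
move=> hc.
pose T (v : 'rV[R]_(C * d)) := [set S : n.-tuple Z | frobnorm (vec_mx v : 'M[R]_(C, d)) <= r ->
  \int[D]_z trunc_loss v z <= emp_risk L S (linhyp (vec_mx v)) + c (dotr v v)].
have mT v : measurable (T v).
  have [vr|vr] := boolP (frobnorm (vec_mx v : 'M[R]_(C, d)) <= r); last first.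
    rewrite (_ : T v = setT)//; apply/seteqP; split => S //= _ h.
    by rewrite h in vr.
  have mg := measurable_emp_risk (n := n) (vec_mx v).
  rewrite (_ : T v = (fun S : n.-tuple Z => emp_risk L S (linhyp (vec_mx v))) @^-1`
      `[\int[D]_z trunc_loss v z - c (dotr v v), +oo[); last first.
    apply/seteqP; split => S /=; rewrite in_itv/= andbT lerBlDr.
      by move=> h; exact: h.
    by move=> h _.
  by rewrite -[X in measurable X]setTI; apply: mg => //; exact: measurable_itv.
pose Q (q : 'rV[rat]_(C * d)) : set (n.-tuple Z) := T (map_mx ratr q).
rewrite (_ : [set S | _] = ~` \bigcup_q ~` Q q); last first.
  rewrite setC_bigcup; apply/seteqP; split => S /=.
    move=> h q _; rewrite setCK /Q /T /= => hq.
    have := h _ hq; rewrite vec_mxK -dotr_mxvec_frobnorm vec_mxK; exact.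
  move=> h W Wr; set v := mxvec W.
  have [K K0 eK] := emp_risk_lipschitz S.
  have lt := lipfam_trunc_loss.
  set K' := `|l| * (d%:R * `|M|) in lt.
  have [K'0 _ Lt _] := lt.
  apply/ler_addgt0Pr => e e0.
  (* Replacing W by a rational point costs K in the empirical risk and K' in the true one; the 1
     keeps the divisor positive. *)
  have e'0 : 0 < e / (K + K' + 1) by rewrite divr_gt0// ltr_wpDl// addr_ge0.
  have [q dq sq] := dist1_rat_dense v e'0.
  set w := map_mx ratr q in dq sq.
  have wv : dotr w w <= dotr v v.
    apply: ler_sum => i _; rewrite -!expr2 -[leLHS]real_normK ?num_real//.
    by rewrite -[leRHS]real_normK ?num_real// ler_sqr ?nnegrE.
  have ff : frobnorm (vec_mx w : 'M[R]_(C, d)) <= frobnorm W.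
    rewrite -ler_sqr ?nnegrE ?sqrtr_ge0// -!dotr_mxvec_frobnorm vec_mxK//.
  have := h q I; rewrite setCK /Q /T /= -/w => /(_ (le_trans ff Wr)) hw.
  have h1 : \int[D]_z trunc_loss v z - \int[D]_z trunc_loss w z <= K' * dist1 v w.
    rewrite -RintB; [|exact: lipfam_bmeas_param lt _..].
    apply: Rint_le => [|z].
      by apply: bmeasB; exact: lipfam_bmeas_param lt _.
    by rewrite (le_trans (ler_norm _)).
  have h2 := le_trans (ler_norm _) (eK w v).
  have h3 : dist1 w v = dist1 v w by apply: eq_bigr => i _; rewrite distrC.
  have h4 : (K + K' + 1) * dist1 v w <= e.
    by rewrite mulrC -ler_pdivlMr ?ltW// ltr_wpDl// addr_ge0.
  have h5 := hc _ _ wv.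
  have h6 := dist1_ge0 v w.
  rewrite h3 /v mxvecK in h2.
  rewrite -dotr_mxvec_frobnorm -/v.
  rewrite /v in h1 h4 h5 h6 hw h2 *; lra.
apply: measurableC; apply: countable_bigcupT_measurable => [|q].
  exact: countableP.
by apply: measurableC; exact: mT.
Qed.

End truncation.

Theorem theorem5p2 (R : realType) (C d n : nat)
  (dY : measure_display) (Y : measurableType dY)
  (X : set 'cV[R]_d) (M : R)
  (hX : forall x, X x -> enorm x <= M)
  (L : 'cV[R]_C -> Y -> R) (A' A l beta : R)
  (hL : forall z y, A' <= L z y <= A)
  (hLip : forall y, elipschitz l (fun z => L z y))
  (hsmooth : forall y, smooth beta (fun z => L z y))
  (hmeas : forall W : 'M[R]_(C, d), measurable_fun setT
     (fun p : 'cV[R]_d * Y => L (linhyp W p.1) p.2))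
  (D : probability ('cV[R]_d * Y)%type R)
  (hD : {ae D, forall p, X p.1})
  (r sigma delta : R)
  (hsigma : 0 < sigma) (hdelta : 0 < delta < 1) (hn : (0 < n)%N) :
  ((1 - delta)%:E <=
   power D n [set S | forall W : 'M[R]_(C, d), (frobnorm W <= r)%R ->
     risk L D (linhyp W) <=
       (if n == 1%N then +oo
        else (emp_risk L S (linhyp W)
          + 2 * Num.sqrt 2 * (beta * r * sigma * C%:R * M ^+ 2 / Num.sqrt n%:R)
          + 4 * beta * C%:R * M ^+ 2 * sigma ^+ 2
              * Num.sqrt (2 * ln (8 / delta) / n%:R)
          + (A - A') * Num.sqrt
              ((frobnorm W ^+ 2 / (2 * sigma ^+ 2) + ln (2 * n%:R / delta))
                 / (2 * (n%:R - 1))))%:E)])%E.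
Proof.
have /andP[d0 d1] := hdelta.
have trivial_event (U : set (n.-tuple ('cV[R]_d * Y))) : U = setT ->
    ((1 - delta)%:E <= power D n U)%E.
  by move=> ->; rewrite probability_setT lee_fin lerBlDr lerDl ltW.
have [n1|n1] := eqVneq n 1%N.
  by apply: trivial_event; apply/seteqP; split => S //= _ W _; exact: leey.
have {}n1 : (1 < n)%N by rewrite ltn_neqAle eq_sym n1.
(* For negative r no W satisfies the norm constraint, and the event is the whole space. *)
have [r0|r0] := leP 0 r; last first.
  apply: trivial_event; apply/seteqP; split => S //= _ W Wr.
  by have := le_lt_trans Wr r0; rewrite ltNge sqrtr_ge0.
have D_ball : {ae D, forall z, in_ball M z}.
  apply: filterS hD => z /hX zM; rewrite /in_ball /= -enorm_sqr.
  by rewrite lerXn2r// nnegrE ?enorm_ge0// (le_trans (enorm_ge0 _) zM).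
pose base := 2 * Num.sqrt 2 * (beta * r * sigma * C%:R * M ^+ 2 / Num.sqrt n%:R)
          + 4 * beta * C%:R * M ^+ 2 * sigma ^+ 2
              * Num.sqrt (2 * ln (8 / delta) / n%:R).
pose c (x : R) := base + (A - A') * Num.sqrt
              ((x / (2 * sigma ^+ 2) + ln (2 * n%:R / delta)) / (2 * (n%:R - 1))).
have A'A : A' <= A by have /andP[h1 h2] := hL 0 point; exact: le_trans h2.
have n1R : 0 < 2 * (n%:R - 1) :> R by rewrite mulr_gt0// subr_gt0 ltr1n.
have hc : {homo c : x y / x <= y}.
  move=> x y xy; rewrite /c lerD2l ler_wpM2l ?subr_ge0// ler_wsqrtr//.
  rewrite ler_pM2r ?invr_gt0// lerD2r ler_pM2r// invr_gt0 mulr_gt0// exprn_gt0//.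
have rE W : risk L D (linhyp W) = (\int[D]_z trunc_loss L A' M (mxvec W) z)%:E.
  by rewrite -(risk_trunc_loss hL hLip hmeas D_ball) mxvecK.
rewrite [X in power D n X](_ : _ = [set S | forall W : 'M[R]_(C, d), frobnorm W <= r ->
    \int[D]_z trunc_loss L A' M (mxvec W) z <=
    emp_risk L S (linhyp W) + c (frobnorm W ^+ 2)]); last first.
  by apply/seteqP; split => S /= h W Wr; have := h W Wr; rewrite rE lee_fin /c /base !addrA.
have mU := measurable_uniform_bound M hL hLip hmeas D (n := n) r hc.
set U := [set S | _] in mU *.
have [E [mE PE hE]] := pac_bayes_chain D n1 (lipfam_trunc_loss M hL hLip hmeas)
  (trunc_curvature_ge0 M hsmooth) r0 hsigma hdelta
  (fun t v z _ => gsmooth_trunc_loss M hL hLip hsmooth hmeas t v z).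
set bad := ~` (@all_in_ball R dY Y d M n).
have bad0 : power D n bad = 0%E by exact: power_all_in_ball.
have mbad : measurable bad by apply: measurableC; exact: measurable_all_in_ball.
(* [E] lies in [U] only up to samples that leave the ball, which form the null set [bad]; hence the
   union bound. *)
rewrite (le_trans PE)// -[leRHS]adde0 -bad0 (le_trans _ (measureU2 _ mU mbad))//.
apply: le_measure; rewrite ?inE//; first exact: measurableU.
move=> S ES; have [Sb|] := pselect (forall i, in_ball M (tnth S i)); last by right.
left => W Wr.
have := hE S (mxvec W) ES; rewrite dotr_mxvec_frobnorm.
have Wr2 : frobnorm W ^+ 2 <= r ^+ 2 by rewrite lerXn2r ?nnegrE ?sqrtr_ge0.
move=> /(_ Wr2); rewrite gap_trunc_loss// mxvecK lerBlDl => /le_trans; apply.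
rewrite lerD2l /c /base.
have -> : Num.sqrt (2 * ln (8 / delta) / n%:R) =
    Num.sqrt 2 * Num.sqrt (ln (8 / delta)) / Num.sqrt n%:R.
  have l0 : 0 <= ln (8 / delta) by rewrite (le_trans ler01)// ln8V_ge1.
  by rewrite sqrtrM ?mulr_ge0// sqrtrM// sqrtrV.
by rewrite le_eqVlt; apply/orP; left; apply/eqP; ring.
Qed.
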